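(* Let $g:[0,\infty)\to[0,1]$ be a non-increasing function with $0<C:=\int_{\mathbb{R}^2}g(\|\boldsymbol{x}\|)\,d\boldsymbol{x}<\infty$ and $g(x)=o\left(\frac{1}{x^2\log^2 x}\right)$ as $x\to\infty$. Let $b=b(\rho)$ be a real-valued function of $\rho$ with $\log\rho+b(\rho)>0$ for all sufficiently large $\rho$, put $r_\rho=\sqrt{\frac{\log\rho+b(\rho)}{C\rho}}$, and let $\mathcal{G}(\mathcal{X}_\rho,g_\rho)$ be the random connection network on the unit square with density $\rho$ in which two nodes at Euclidean distance $x$ are directly connected with probability $g(x/r_\rho)$. Then $b(\rho)\to\infty$ is a necessary condition for $\mathcal{G}(\mathcal{X}_\rho,g_\rho)$ to be asymptotically almost surely connected as $\rho\to\infty$; that is, if $\lim_{\rho\to\infty}\Pr\left(\mathcal{G}(\mathcal{X}_\rho,g_\rho)\text{ is connected}\right)=1$, then $b(\rho)\to\infty$ as $\rho\to\infty$.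
   Context: The network $\mathcal{G}(\mathcal{X}_\rho,g_\rho)$: the nodes form a homogeneous Poisson point process $\mathcal{X}_\rho$ of density $\rho$ on the unit square $\left[-\frac12,\frac12\right)^2$. Given the node positions, each pair of nodes separated by Euclidean distance $x$ is directly connected (joined by an edge) with probability $g(x/r_\rho)$, independently of all other pairs. A network is connected if there is a path of direct connections between any pair of nodes. An event depending on $\rho$ occurs asymptotically almost surely if its probability tends to $1$ as $\rho\to\infty$. $\|\cdot\|$ is the Euclidean norm. *)

(* Defs.v *)
From HB Require Import structures.
From mathcomp Require Import all_boot all_order all_algebra.
From mathcomp Require Import all_classical all_reals all_analysis.

Set Implicit Arguments.
Unset Strict Implicit.
Unset Printing Implicit Defensive.

Import Order.TTheory GRing.Theory Num.Theory.
Import numFieldNormedType.Exports.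

Local Open Scope classical_set_scope.
Local Open Scope ring_scope.

(* Needed by the notation [=o_+oo]: the library has no such instance. *)
Canonical pinfty_filter_on (R : realType) :=
  FilterType (pinfty_nbhs R) (@proper_pinfty_nbhs R).

Section plane.
Context {R : realType}.

(* The library norm on [R * R] is the sup norm, hence this definition. *)
Definition euclid_norm (z : R * R) : R := Num.sqrt (z.1 ^+ 2 + z.2 ^+ 2).

(* [lebesgue_measure] is declared on [measurableTypeR R], which is convertible
   to [R] with its Borel sigma-algebra. *)
Definition plane_measure :
    {measure set (measurableTypeR R * measurableTypeR R) -> \bar R} :=
  (@lebesgue_measure R \x @lebesgue_measure R)%E.

Definition unit_square : set (R * R) :=
  `[- 2^-1, 2^-1[%classic `*` `[- 2^-1, 2^-1[%classic.

End plane.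

(* A random finite graph embedded in the plane: in the outcome [w], the nodes
   are the indices [i < node_count w], node [i] sits at [position i w], and
   [edge i j w] tells whether [i] and [j] are directly connected.  The values
   of [position] and [edge] at indices [>= node_count w] carry no meaning. *)
Record network (R : realType) (d : measure_display) (T : measurableType d) :=
  Network {
    node_count : T -> nat;
    position : nat -> T -> R * R;
    edge : nat -> nat -> T -> bool }.

Section network_theory.
Context {R : realType} {d : measure_display} {T : measurableType d}.
Implicit Types (P : probability T R) (G : network R T).

Definition nodes_in G (A : set (R * R)) (w : T) : nat :=
  (\sum_(i < node_count G w) (position G i w \in A))%N.

(* [poisson_pmf 0 k] is [1] for every [k] in the library, whereas null sets
   must contain no node almost surely, hence the explicit mass function. *)
Definition poisson_nodes P (rho : R) G : Prop :=
  [/\ measurable_fun [set: T] (node_count G),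
      forall i, measurable_fun [set: T] (position G i),
      forall w i, (i < node_count G w)%N -> unit_square (position G i w),
      forall A : set (R * R), measurable A -> A `<=` unit_square ->
        let rate := rho * fine (plane_measure A) in
        forall k : nat, P [set w | nodes_in G A w = k]
          = (rate ^+ k / k`!%:R * expR (- rate))%:E
    & forall (m : nat) (A : 'I_m -> set (R * R)),
        (forall i, measurable (A i)) -> (forall i, A i `<=` unit_square) ->
        trivIset [set: 'I_m] A ->
        forall k : 'I_m -> nat, P [set w | forall i, nodes_in G (A i) w = k i]
          = (\prod_(i < m) P [set w | nodes_in G (A i) w = k i])%E].

Definition positions G (n : nat) (w : T) : n.-tuple (R * R) :=
  [tuple position G i w | i < n].

(* Probability that the edges present among [n] nodes placed at [x] are exactly
   those prescribed by [h], when the pairs are connected independently, with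
   probability [f t] for a pair at distance [t]. *)
Definition edge_weight (f : R -> R) (n : nat) (h : rel 'I_n)
    (x : n.-tuple (R * R)) : R :=
  \prod_(ij : 'I_n * 'I_n | (ij.1 < ij.2)%N)
    let p := f (euclid_norm (tnth x ij.1 - tnth x ij.2)) in
    if h ij.1 ij.2 then p else 1 - p.

(* The last clause says that [edge_weight] is the conditional law of the edges
   given the number and the positions of the nodes: it is tested against every
   event of the sigma-algebra that these generate. *)
Definition independent_edges P (f : R -> R) G : Prop :=
  [/\ forall i j, measurable_fun [set: T] (edge G i j),
      forall i j w, edge G i j w = edge G j i w,
      forall i w, ~~ edge G i i w
    & forall (n : nat) (B : set (n.-tuple (R * R))) (h : rel 'I_n),
        measurable B ->
        let D := [set w | node_count G w = n /\ B (positions G n w)] in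
        P (D `&` [set w | forall i j : 'I_n, (i < j)%N -> edge G i j w = h i j])
          = (\int[P]_(w in D) (edge_weight f h (positions G n w))%:E)%E].

(* [G] is a random connection network on the unit square, with node density
   [rho] and connection function [f]. *)
Definition random_connection_network P (rho : R) (f : R -> R) G : Prop :=
  poisson_nodes P rho G /\ independent_edges P f G.

Definition is_connected G (w : T) : Prop :=
  forall i j : 'I_(node_count G w),
    connect (fun k l : 'I_(node_count G w) => edge G k l w) i j.

End network_theory.

Definition connection_range {R : realType} (C : R) (b : R -> R) (rho : R) : R :=
  Num.sqrt ((ln rho + b rho) / (C * rho)).

(* Main.v *)
(* Let W count the isolated nodes in the inner square [-1/4, 1/4]^2.  A network
   with an isolated node and at least two nodes is disconnected, and
   t (2 - t) W <= 1_(W > 0) + t^2 W (W - 1) pointwise, so for 0 <= t <= 2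
     t (2 - t) E W <= P(not connected) + rho e^(-rho) + t^2 E (W (W - 1)).
   A node at x of a Poisson process is isolated with probability
   exp (- rho deg x), deg x <= C r^2, hence E W >= e^(-b) / 4.  Two nodes at x
   and y are both isolated with probability at most exp (- rho (deg x + cr)),
   where cr = \int phi(y, z) (1 - phi(x, z)) dz.  With s = r sqrt(rho r^2 C):
   - if |x - y| > s, the tail g t <= C / t^2 gives cr >= deg y - 8 C / rho;
   - if |x - y| <= s, a ball inside a crescent gives
     cr >= tau / 2 * min (|x - y| / 2, l r)^2, where g >= tau below l and
     g <= 1/2 above l.
   Integrating, E (W (W - 1)) <= m (e^(8 C) m + K) with m = E W and K depending
   only on g.  If b <= M for arbitrarily large rho, then E W is bounded below,
   and a suitable t keeps P(not connected) away from 0. *)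

Require Import Defs.
From HB Require Import structures.
From mathcomp Require Import all_boot all_order all_algebra fingroup perm.
From mathcomp Require Import all_classical all_reals all_analysis.
From mathcomp Require Import measurable_realfun ring lra.

Set Implicit Arguments.
Unset Strict Implicit.
Unset Printing Implicit Defensive.

Import Order.TTheory GRing.Theory Num.Theory.
Import numFieldNormedType.Exports.

Local Open Scope classical_set_scope.
Local Open Scope ring_scope.

(** The Poisson hypothesis speaks of counts only and leaves the numbering of the nodes arbitrary, so
    a single [position G i] has no known law. What the counts do determine, for each number of
    nodes, is the sum over all renumberings of the law of the positions. Sums over nodes, or over
    ordered pairs of nodes, are blind to the numbering, so this is enough for both moments. The
    moment inequality is linear in the probabilities and carries a free parameter, where a quotient
    of moments might be expected: it can be proved for each number of nodes and then added up, and
    it asks only for an upper bound on the second factorial moment. Apart from [0 < ln rho + b rho],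
    nothing bounds [b] from below: the mean [m] may be huge and the expected degree close to 0.
    Hence the constants must not depend on [rho], and the parameter is tuned to [m]. The inner
    square serves the crescents: a disk of radius at most 1/4 about one of its points stays in the
    unit square, so the lower bound on [cr] suffers no boundary effect. The price is the factor 1/4
    in E W. *)

(** * Powers of a probability measure, on tuples *)

Section tuple_power.
Local Open Scope ereal_scope.
Context {dE : measure_display} {E : measurableType dE} {R : realType}.
Variable nu : probability E R.

Definition tuple_cons n (z : E * n.-tuple E) : n.+1.-tuple E := [tuple of z.1 :: z.2].

Lemma measurable_tuple_cons n : measurable_fun setT (@tuple_cons n).
Proof. exact: (@measurable_cons _ _ _ _ fst n snd). Qed.

HB.instance Definition _ n :=
  isMeasurableFun.Build _ _ _ _ (@tuple_cons n) (@measurable_tuple_cons n).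

(** The law of [n] independent points. Recursion on the head lets Tonelli's theorem peel off
    distinguished points one at a time. *)
Fixpoint tuple_power n : probability (n.-tuple E) R :=
  if n is m.+1 then distribution (nu \x tuple_power m) (@tuple_cons m)
  else dirac [tuple].

Lemma integral_tuple_powerS n (f : n.+1.-tuple E -> \bar R) :
  measurable_fun [set: n.+1.-tuple E] f -> (forall x, 0 <= f x) ->
  \int[tuple_power n.+1]_x f x =
  \int[nu]_x \int[tuple_power n]_t f [tuple of x :: t].
Proof.
move=> mf f0; rewrite ge0_integral_distribution//.
rewrite fubini_tonelli1//=.
apply: measurableT_comp => //; exact: measurable_tuple_cons.
Qed.

Lemma measurable_prod_tnth n (f : E -> R) : measurable_fun setT f ->
  measurable_fun [set: n.-tuple E] (fun t => (\prod_(j < n) f (tnth t j))%R).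
Proof.
move=> mf; apply: measurable_prod => j _.
by apply: measurableT_comp => //; exact: measurable_tnth.
Qed.

Lemma integral_tuple_power_prod n (f : E -> R) :
  measurable_fun setT f -> (forall x, 0 <= f x)%R ->
  \int[tuple_power n]_t (\prod_(j < n) f (tnth t j))%R%:E =
  (\int[nu]_x (f x)%:E) ^+ n.
Proof.
move=> mf f0; elim: n => [|n IH].
  rewrite /= integral_dirac//; last first.
    by apply/measurable_EFinP; exact: measurable_prod_tnth.
  by rewrite diracT mul1e big_ord0.
rewrite integral_tuple_powerS; last 2 first.
- by apply/measurable_EFinP; exact: measurable_prod_tnth.
- by move=> x; rewrite lee_fin; exact: prodr_ge0.
rewrite expeS -IH -ge0_integralZr//; last 3 first.
- exact/measurable_EFinP.
- by move=> x _; rewrite lee_fin.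
- by apply: integral_ge0 => t _; rewrite lee_fin; exact: prodr_ge0.
apply: eq_integral => x _; rewrite -ge0_integralZl//; last 3 first.
- by apply/measurable_EFinP; exact: measurable_prod_tnth.
- by move=> t _; rewrite lee_fin; exact: prodr_ge0.
- by rewrite lee_fin.
apply: eq_integral => t _; rewrite big_ord_recl tnth0 EFinM; congr (_ * _%:E).
by apply: eq_bigr => j _; rewrite tnthS.
Qed.

End tuple_power.

(** * Finite families of events *)

Lemma measurable_forall_fin d (T : measurableType d) (I : finType)
    (F : I -> set T) : (forall i, measurable (F i)) ->
  measurable [set x | forall i, F i x].
Proof.
move=> mF; rewrite (_ : mkset _ = \bigcap_(i in [set: I]) F i).
  by apply: fin_bigcap_measurable => // i _; exact: mF.
by apply/seteqP; split => x /= Fx i => [_|]; exact: Fx.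
Qed.

Lemma measurable_exists_fin d (T : measurableType d) (I : finType)
    (F : I -> set T) : (forall i, measurable (F i)) ->
  measurable [set x | exists i, F i x].
Proof.
move=> mF; rewrite (_ : mkset _ = \bigcup_(i in [set: I]) F i).
  by apply: fin_bigcup_measurable => // i _; exact: mF.
by apply/seteqP; split => x /= [i]; [exists i|move=> _; exists i].
Qed.

Lemma measure_exists_fin_null d (T : measurableType d) (R : realType)
    (mu : {measure set T -> \bar R}) (I : finType) (F : I -> set T) :
  (forall i, measurable (F i)) -> (forall i, mu (F i) = 0%E) ->
  mu [set x | exists i, F i x] = 0%E.
Proof.
move=> mF F0; apply/negligibleP; first exact: measurable_exists_fin.
pose F' k := if unpickle k is Some i then F i else set0.
apply: (@negligibleS _ _ _ mu (\bigcup_k F' k)).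
  by move=> x [i Fix]; exists (pickle i) => //; rewrite /F' pickleK.
apply: negligible_bigcup => k; rewrite /F'; case: unpickle => [i|].
  by apply/negligibleP; [exact: mF|exact: F0].
by apply/negligibleP => //; exact: measure0.
Qed.

(** * Boxes and coincidences under a power of a law *)

Section tuple_measures.
Local Open Scope ereal_scope.
Context {dE : measure_display} {E : measurableType dE} {R : realType}.
Variables (nu : probability E R) (h : E -> R).
Hypotheses (mh : measurable_fun [set: E] h)
  (h_null : forall a, nu (h @^-1` [set a]) = 0).

Definition box n (A : 'I_n -> set E) : set (n.-tuple E) :=
  [set t | forall i, A i (tnth t i)].

Lemma measurable_tnth_preimage n (i : 'I_n) (A : set E) : measurable A ->
  measurable [set t : n.-tuple E | A (tnth t i)].
Proof.
by move=> mA; rewrite -[mkset _]setTI; exact: (@measurable_tnth _ _ n i).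
Qed.

Lemma measurable_box n (A : 'I_n -> set E) :
  (forall i, measurable (A i)) -> measurable (box A).
Proof.
move=> mA; apply: (@measurable_forall_fin _ (n.-tuple E)) => i.
exact: measurable_tnth_preimage.
Qed.

Lemma tuple_power_box n (A : 'I_n -> set E) : (forall i, measurable (A i)) ->
  tuple_power nu n (box A) = \prod_(i < n) nu (A i).
Proof.
elim: n => [|n IH] in A *; move=> mA.
  rewrite big_ord0 /= diracE mem_set//.
  by case.
pose A' (i : 'I_n) := A (lift ord0 i).
have -> : tuple_power nu n.+1 (box A) =
    (nu \x tuple_power nu n) (A ord0 `*` box A').
  congr ((nu \x tuple_power nu n) _).
  apply/seteqP; split => -[x t] /=.
    move=> At; split=> /=; first by have := At ord0; rewrite tnth0.
    by move=> i; have := At (lift ord0 i); rewrite tnthS.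
  move=> [Ax At] i; have [->|[j ->]] : i = ord0 \/ exists j, i = lift ord0 j.
    by case: (unliftP ord0 i) => [j|] ->; [right; exists j|left].
  - by rewrite tnth0.
  - by rewrite tnthS; exact: At.
have mA' i : measurable (A' i) by exact: mA.
transitivity (nu (A ord0) * tuple_power nu n (box A')).
  by apply: product_measure1E => //; exact: measurable_box.
by rewrite IH// big_ord_recl.
Qed.

Lemma measurable_tnth_eq n (i j : 'I_n) :
  measurable [set t : n.-tuple E | h (tnth t i) = h (tnth t j)].
Proof.
have mc k : measurable_fun [set: n.-tuple E] (fun t => h (tnth t k)).
  by apply: measurableT_comp => //; exact: measurable_tnth.
have := @measurable_fun_eqr _ _ _ _ _ _ (mc i) (mc j) measurableT [set true] I.
rewrite setTI; congr measurable.
by apply/seteqP; split => t /= /eqP.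
Qed.

Lemma tuple_power_eq_null n (i j : 'I_n) : (i < j)%N ->
  tuple_power nu n [set t | h (tnth t i) = h (tnth t j)] = 0.
Proof.
elim: n => [|n IH] in i j *; first by case: i.
have [j' ->|->] := unliftP ord0 j; last by rewrite ltn0.
have [i' ->|->] := unliftP ord0 i => ij.
  have -> : tuple_power nu n.+1
      [set t | h (tnth t (lift ord0 i')) = h (tnth t (lift ord0 j'))] =
      (nu \x tuple_power nu n)
      (setT `*` [set t | h (tnth t i') = h (tnth t j')]).
    congr ((nu \x tuple_power nu n) _).
    by apply/seteqP; split => -[x t] /=; rewrite !tnthS//; case.
  transitivity (nu setT * tuple_power nu n [set t | h (tnth t i') = h (tnth t j')]).
    by apply: product_measure1E => //; exact: measurable_tnth_eq.
  by rewrite IH ?mule0.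
(* Here the head is one of the two points. For a fixed head [x] the section is a box whose side at
   [j'] is a level set of [h], hence null. *)
rewrite /tuple_power -/(tuple_power nu n) /distribution /pushforward /=.
rewrite /product_measure1; apply: integral0_eq => x _ /=.
have := tuple_power_box (A := fun k : 'I_n =>
  if k == j' then h @^-1` [set h x] else setT).
rewrite (bigD1 j')//= eqxx h_null mul0e => <-.
  congr (tuple_power nu n _); apply/seteqP; split => t.
    rewrite /xsection/= inE /= tnth0 tnthS => e k.
    by case: eqP => [->|].
  by rewrite /xsection/= inE /= tnth0 tnthS => /(_ j'); rewrite eqxx => ->.
move=> k; case: eqP => // _.
by rewrite -[_ @^-1` _]setTI; apply: mh => //; exact: measurable_set1.
Qed.

Definition distinct n : set (n.-tuple E) :=
  [set t | forall i j, h (tnth t i) = h (tnth t j) -> i = j].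

Let collision n (p : 'I_n * 'I_n) : set (n.-tuple E) :=
  if (p.1 < p.2)%N then [set t | h (tnth t p.1) = h (tnth t p.2)] else set0.

Let measurable_collision n (p : 'I_n * 'I_n) : measurable (collision p).
Proof. by rewrite /collision; case: ifP => // _; exact: measurable_tnth_eq. Qed.

Let setC_distinct n :
  ~` @distinct n = [set t | exists p : 'I_n * 'I_n, collision p t].
Proof.
apply/seteqP; split => t /=.
  move=> /existsNP[i /existsNP[j /not_implyP[hij]]].
  move=> /eqP; rewrite neq_ltn => /orP[ij|ji].
    by exists (i, j); rewrite /collision ij.
  by exists (j, i); rewrite /collision ji.
move=> [[i j]]; rewrite /collision/=; case: ifP => // ij hij /(_ i j hij) eij.
by move: ij; rewrite eij ltnn.
Qed.

Lemma measurable_distinct n : measurable (@distinct n).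
Proof.
rewrite -[@distinct n]setCK setC_distinct; apply: measurableC.
by apply: (@measurable_exists_fin _ (n.-tuple E)); exact: measurable_collision.
Qed.

Lemma tuple_power_distinct n : tuple_power nu n (~` @distinct n) = 0.
Proof.
rewrite setC_distinct.
apply: (@measure_exists_fin_null _ (n.-tuple E)) => p.
  exact: measurable_collision.
rewrite /collision; case: ifP => [|_]; first exact: tuple_power_eq_null.
exact: measure0.
Qed.

End tuple_measures.

(** * Uniqueness of measures on tuples *)

Section tuple_measure_unique.
Context {dE : measure_display} {E : measurableType dE} {R : realType}.
Variables (h : E -> R) (mh : measurable_fun [set: E] h) (n : nat).
Implicit Types A : 'I_n -> set E.

(** The images of the sides under [h] are disjoint, not merely the sides: this puts the whole box
    inside [distinct]. *)
Definition separated A :=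
  forall i j x y, A i x -> A j y -> h x = h y -> i = j.

Lemma separated_sub A A' : separated A -> (forall i, A' i `<=` A i) -> separated A'.
Proof. by move=> sA A'A i j x y /A'A Ax /A'A Ay; exact: sA Ax Ay. Qed.

Lemma box_separated_distinct A : separated A -> box A `<=` distinct h (n:=n).
Proof. by move=> sA t At i j; exact: (sA _ _ _ _ (At i) (At j)). Qed.

(** Preimages of the cells of a grid of mesh [1 / m.+1]. They supply countably many separated boxes
    that exhaust [distinct]. *)
Let strip (m : nat) (a : int) : set E :=
  h @^-1` `[a%:~R / m.+1%:R, (a + 1)%:~R / m.+1%:R[%classic.

Let stripE m a x : strip m a x -> Num.floor (m.+1%:R * h x) = a.
Proof.
rewrite /strip /= in_itv /= => /andP[ah ha].
apply: floor_def; rewrite mulrC.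
by rewrite -ler_pdivrMr// ah/= -ltr_pdivlMr.
Qed.

Let strip_floor m x : strip m (Num.floor (m.+1%:R * h x)) x.
Proof.
rewrite /strip /= in_itv /= ler_pdivrMr// ltr_pdivlMr// (mulrC (h x)).
exact: floor_itv.
Qed.

Let measurable_strip m a : measurable (strip m a).
Proof. by rewrite -[strip m a]setTI; apply: mh. Qed.

(* Two distinct reals lie in distinct cells of every sufficiently fine grid. *)
Let floor_separates (a b : R) : a != b ->
  exists k : nat, forall m : nat, (k <= m)%N ->
    Num.floor (m.+1%:R * a) != Num.floor (m.+1%:R * b).
Proof.
move=> ab; have d0 : 0 < `|a - b| by rewrite normr_gt0 subr_eq0.
exists (Num.truncn `|a - b|^-1) => m km; apply/eqP => fab.
have := floor_itv (m.+1%:R * a); have := floor_itv (m.+1%:R * b).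
rewrite fab intrD; set f := (_%:~R) => /andP[b1 b2] /andP[a1 a2].
have : `|m.+1%:R * a - m.+1%:R * b| < 1 by rewrite ltr_norml; lra.
rewrite -mulrBr normrM ger0_norm// => mab.
have : `|a - b|^-1 < m.+1%:R.
  by rewrite (lt_le_trans (truncnS_gt _))// ler_nat.
rewrite -[ltLHS]mul1r ltr_pdivrMr// => /(lt_trans mab).
by rewrite ltxx.
Qed.

(** Only finitely many pairs are to be separated, so the largest of their thresholds serves them
    all. *)
Let distinct_strip (t : n.-tuple E) : distinct h t ->
  exists m, injective (fun i => Num.floor (m.+1%:R * h (tnth t i))).
Proof.
move=> dt; pose k (p : 'I_n * 'I_n) : nat :=
  if pselect (p.1 <> p.2 ) is left _ then
    xget 0%N [set k : nat | forall m : nat, (k <= m)%N ->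
    Num.floor (m.+1%:R * h (tnth t p.1)) != Num.floor (m.+1%:R * h (tnth t p.2))]
  else 0%N.
exists (\max_p k p) => i j; apply: contraPP => ij.
have hij : h (tnth t i) != h (tnth t j) by apply/eqP => /dt.
apply/eqP; have : (k (i, j) <= \max_p k p)%N by exact: leq_bigmax.
rewrite {1}/k/=; case: pselect => // _.
have [k0 Hk0] := floor_separates hij.
by case: xgetP => [z _ + /[dup] zm|/(_ k0)//]; apply.
Qed.

(** Uniqueness of measures needs a countable cover by members of the generating family. The tuples
    with a repeated value therefore form a piece too, and this piece is also the default for codes
    that name no separated box. *)
Let piece (k : nat) : set (n.-tuple E) :=
  if unpickle k is Some (m, c) then
    if injectiveb (c : {ffun 'I_n -> int}) then box (fun i => strip m (c i))
    else ~` distinct h (n:=n)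
  else ~` distinct h (n:=n).

Let strip_separated m (c : {ffun 'I_n -> int}) : injectiveb c ->
  separated (fun i => strip m (c i)).
Proof.
move=> /injectiveP ic i j x y /stripE xi /stripE yj xy.
by apply: ic; rewrite -xi -yj xy.
Qed.

Let piece_cover : \bigcup_k piece k = setT.
Proof.
apply/seteqP; split => // t _.
have [/distinct_strip[m im]|nt] := pselect (distinct h t).
  exists (pickle (m, [ffun i => Num.floor (m.+1%:R * h (tnth t i))])) => //.
  rewrite /piece pickleK; case: injectiveP => [_|].
    by move=> i; rewrite ffunE; exact: strip_floor.
  by case=> i j; rewrite !ffunE; exact: im.
(* A constant choice of strips codes the exceptional piece: if it were injective there would be at
   most one index, and [t] would be distinct. *)
exists (pickle (0%N, [ffun i : 'I_n => 0 : int])) => //.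
rewrite /piece pickleK; case: injectiveP => // ic.
by case: nt => i j _; apply: ic; rewrite !ffunE.
Qed.

(** Separated boxes cannot reach tuples with a repeated value. All measurable sets of such tuples
    are added so that [G] generates the full sigma-algebra; on them the comparison is trivial, since
    both measures get restricted to [distinct]. *)
Let G : set (set (n.-tuple E)) :=
  [set B | (exists A, [/\ forall i, measurable (A i), separated A & B = box A])
        \/ (measurable B /\ B `<=` ~` distinct h (n:=n))].

Let G_measurable : G `<=` measurable.
Proof. by move=> B [[A [mA _ ->]]|[]//]; exact: measurable_box. Qed.

Let G_setI : setI_closed G.
Proof.
move=> B B' [[A [mA sA ->]]|[mB BD]] GB'; last first.
  by right; split; [exact: measurableI (G_measurable GB')|move=> x [/BD]].
case: GB' => [[A' [mA' sA' ->]]|[mB BD]]; last first.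
  by right; split; [apply: measurableI => //; exact: measurable_box|move=> x [_ /BD]].
left; exists (fun i => A i `&` A' i); split.
- by move=> i; exact: measurableI.
- by apply: separated_sub sA _ => i x [].
- by apply/seteqP; split => t; [move=> [At A't] i; split; [exact: At|exact: A't]
    |move=> At; split => i; case: (At i)].
Qed.

Let G_piece k : G (piece k).
Proof.
rewrite /piece; case: unpickle => [[m c]|].
  case: ifPn => [ic|_].
    left; exists (fun i => strip m (c i)); split => //.
    exact: strip_separated.
  by right; split => //; apply: measurableC; exact: measurable_distinct.
by right; split => //; apply: measurableC; exact: measurable_distinct.
Qed.

Let G_generates : measurable = <<s G >>.
Proof.
apply/seteqP; split; last first.
  by apply: smallest_sub => //; exact: sigma_algebra_measurable.
apply: smallest_sub; first exact: smallest_sigma_algebra.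
move=> B; rewrite -bigcup_seq => -[i _ [Y mY <-]].
(* The preimage of [Y] is cut along the countable cover; within a box, the cut merely shrinks the
   side at [i]. *)
rewrite setTI -[_ @^-1` _]setIT -piece_cover setI_bigcupr.
apply: sigma_algebra_bigcup => k; apply: sub_gen_smallest.
have mYi : measurable ((tnth (T:=E))^~ i @^-1` Y : set (n.-tuple E)).
  exact: measurable_tnth_preimage.
case: (G_piece k) => [[A [mA sA ->]]|[mB BD]]; last first.
  by right; split; [exact: measurableI|move=> x [_ /BD]].
left; exists (fun j => A j `&` (if j == i then Y else setT)); split.
- by move=> j; apply: measurableI => //; case: ifP.
- by apply: separated_sub sA _ => j x [].
- apply/seteqP; split => t.
    by move=> [/= Yt At] j; split; [exact: At|case: eqP => [->|]].
  move=> At; split; first by case: (At i); rewrite eqxx.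
  by move=> j; case: (At j).
Qed.

(* Only boxes with separated sides can be compared through counts of nodes; they
   generate the sigma-algebra up to the null set of tuples on which [h]
   repeats a value. *)
Lemma tuple_measure_unique
    (m1 m2 : {measure set (n.-tuple E) -> \bar R}) :
  (m1 setT < +oo)%E -> m1 setT = m2 setT -> m2 (~` distinct h (n:=n)) = 0%E ->
  (forall A, (forall i, measurable (A i)) -> separated A ->
    m1 (box A) = m2 (box A)) ->
  forall B, measurable B -> m1 B = m2 B.
Proof.
move=> m1oo m12T m2D m12 B mB.
have mD : measurable (distinct h (n:=n)) by exact: measurable_distinct.
have r12 : forall B, measurable B -> m1 (B `&` distinct h (n:=n)) = m2 (B `&` distinct h (n:=n)).
  move=> {mB}B mB.
  apply: (@measure_unique _ _ _ G piece G_generates G_setI G_piece piece_cover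
    (mrestr m1 mD) (mrestr m2 mD)) => //.
    move=> C [[A [mA sA ->]]|[mC CD]].
      rewrite /= /mrestr setIidl; first exact: m12.
      exact: box_separated_distinct.
    rewrite /= /mrestr (_ : _ `&` _ = set0) ?measure0//.
    by apply/seteqP; split => // x [/CD].
  move=> k; rewrite /= /mrestr (le_lt_trans _ m1oo)// le_measure ?inE//.
  by apply: measurableI => //; exact: G_measurable.
have split_distinct (m : {measure set (n.-tuple E) -> \bar R}) C :
    measurable C ->
    m C = (m (C `\` distinct h (n:=n)) + m (C `&` distinct h (n:=n)))%E.
  by move=> mC; exact: measureDI.
(* The total masses agree and are finite, and so do the masses of [distinct]; hence [m1] inherits
   the null set of [m2]. *)
have m1D : m1 (~` distinct h (n:=n)) = 0%E.
  have := split_distinct m1 _ measurableT; have := split_distinct m2 _ measurableT.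
  rewrite !setTD m2D add0e -r12// => <-; rewrite -m12T.
  have : m1 setT \is a fin_num by rewrite ge0_fin_numE.
  move: (m1 (~` _)) (measure_ge0 m1 (~` distinct h (n:=n))).
  case: (m1 setT) => // r [s||]//= s0 _.
  by rewrite -EFinD => -[] e; congr EFin; lra.
rewrite (split_distinct m1 _ mB) (split_distinct m2 _ mB) r12//.
congr (_ + _)%E.
have null (m : {measure set (n.-tuple E) -> \bar R}) :
    m (~` distinct h (n:=n)) = 0%E -> m (B `\` distinct h (n:=n)) = 0%E.
  move=> m0; apply/eqP; rewrite -measure_le0 -m0 le_measure ?inE//.
  - exact: measurableD.
  - exact: measurableC.
by transitivity (0 : \bar R); [exact: null|apply/esym; exact: null].
Qed.

End tuple_measure_unique.

Lemma measure_exists_fin d (T : measurableType d) (R : realType)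
    (mu : {measure set T -> \bar R}) (I : finType) (F : I -> set T) :
  (forall i, measurable (F i)) -> (forall i j x, F i x -> F j x -> i = j) ->
  mu [set x | exists i, F i x] = (\sum_i mu (F i))%E.
Proof.
move=> mF dF; rewrite fsbig_seq/=; last exact: index_enum_uniq.
rewrite (_ : mkset _ = \bigcup_(i in [set` index_enum I]) F i).
  apply: measure_fin_bigcup => //.
  by move=> i j _ _ [x [Fi Fj]]; exact: dF Fi Fj.
apply/seteqP; split => x /=.
  by move=> [i Fi]; exists i => //=; rewrite mem_index_enum.
by move=> [i _ Fi]; exists i.
Qed.

Lemma ge0_integral_mrestr d (T : measurableType d) (R : realType)
    (mu : {measure set T -> \bar R}) (D : set T) (mD : measurable D)
    (f : T -> \bar R) : measurable_fun [set: T] f -> (forall x, 0 <= f x)%E ->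
  (\int[mrestr mu mD]_x f x = \int[mu]_(x in D) f x)%E.
Proof.
move=> mf f0.
rewrite (@ge0_negligible_integral _ _ _ (mrestr mu mD) setT (~` D))//.
- rewrite setTD setCK; apply: eq_measure_integral => A mA AD.
  by rewrite /= /mrestr setIidl.
- exact: measurableC.
- by rewrite /= /mrestr setICl measure0.
Qed.

(** * From Poisson counts to the symmetrized law of the positions *)

Section poisson_law.
Local Open Scope ereal_scope.
Context {d dE : measure_display} {T : measurableType d} {E : measurableType dE}
  {R : realType}.
Variables (P : probability T R) (nu : probability E R) (rho : R).
Variables (N : T -> nat) (X : nat -> T -> E) (h : E -> R).
Hypotheses (mN : measurable_fun [set: T] N)
  (mX : forall i, measurable_fun [set: T] (X i))
  (mh : measurable_fun [set: E] h)
  (h_null : forall a, nu (h @^-1` [set a]) = 0).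

Definition points_in (A : set E) (w : T) : nat :=
  (\sum_(i < N w) (X i w \in A))%N.

Hypothesis count_law : forall A, measurable A -> forall k,
  P [set w | points_in A w = k] =
  (let rate := rho * fine (nu A) in
   rate ^+ k / k`!%:R * expR (- rate))%R%:E.

Hypothesis count_independent : forall m (A : 'I_m -> set E),
  (forall i, measurable (A i)) -> trivIset [set: 'I_m] A ->
  forall k : 'I_m -> nat,
    P [set w | forall i, points_in (A i) w = k i] =
    \prod_(i < m) P [set w | points_in (A i) w = k i].

Lemma points_inE n A w : N w = n ->
  points_in A w = (\sum_(i < n) (X i w \in A))%N.
Proof. by rewrite /points_in => ->. Qed.

Lemma measurable_count n : measurable [set w | N w = n].
Proof. by rewrite -[mkset _]setTI; exact: (mN measurableT (Y := [set n])). Qed.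

Definition permuted_points n (s : 'S_n) (w : T) : n.-tuple E :=
  [tuple X (s i) w | i < n].

Lemma measurable_permuted_points n (s : 'S_n) :
  measurable_fun [set: T] (permuted_points s).
Proof.
apply/measurable_fun_tnthP => i.
rewrite (_ : _ \o _ = X (s i))//.
by apply/funext => w; rewrite /= /permuted_points tnth_mktuple.
Qed.

(* The counts do not see the numbering of the nodes, hence the sum over all
   numberings: the cells [A i] and their complement contain one node each and
   none, respectively, iff exactly one renumbering puts the nodes in [box A]. *)
Lemma symmetrized_box n (A : 'I_n -> set E) : (forall i, measurable (A i)) ->
  (forall i j x, A i x -> A j x -> i = j) ->
  \sum_(s : 'S_n) P [set w | N w = n /\ box A (permuted_points s w)] =
  (expR (- rho) * rho ^+ n)%R%:E * \prod_(i < n) nu (A i).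
Proof.
move=> mA dA.
pose rest := ~` [set x | exists i, A i x].
have mrest : measurable rest by apply: measurableC; exact: measurable_exists_fin.
(* Index [ord0] stands for the complement of the cells, which is to hold no node; every other index
   stands for an [A i], which is to hold one. *)
pose B (j : 'I_n.+1) := if unlift ord0 j is Some i then A i else rest.
pose k (j : 'I_n.+1) : nat := unlift ord0 j : bool.
have mB j : measurable (B j) by rewrite /B; case: unlift.
have dB i j x : B i x -> B j x -> i = j.
  rewrite /B; case: (unliftP ord0 i) => [i' ->|->];
    case: (unliftP ord0 j) => [j' ->|->] //.
  - by move=> Ai /(dA _ _ _ Ai) ->.
  - by move=> Ai []; exists i'.
  - by move=> /[swap] Ai []; exists j'.
have cB x : exists j, B j x.
  have [[i Ai]|nA] := pselect (exists i, A i x).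
    by exists (lift ord0 i); rewrite /B liftK.
  by exists ord0; rewrite /B unlift_none.
have -> : \sum_(s : 'S_n) P [set w | N w = n /\ box A (permuted_points s w)] =
    P [set w | forall j, points_in (B j) w = k j].
  rewrite -(measure_exists_fin P); last 2 first.
  - move=> s; apply: measurableI; first exact: measurable_count.
    rewrite -[X in measurable X]setTI.
    by apply: measurable_permuted_points => //; exact: measurable_box.
  - move=> s s' w /= [_ ws] [_ ws']; apply/permP => i.
    have := ws ((s^-1)%g (s' i)); have := ws' i.
    rewrite !tnth_mktuple permKV => a' a.
    by rewrite -[RHS](permKV s) -(dA _ _ _ a' a).
  congr (P _); apply/seteqP; split => w /=.
    move=> [s [Nw ws]] j; rewrite (points_inE _ Nw).
    rewrite (reindex_inj (@perm_inj _ s))/=.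
    have [i ->|->] := unliftP ord0 j; rewrite /k /B ?liftK ?unlift_none/=.
      rewrite (bigD1 i)//= big1 ?addn0.
        by rewrite mem_set//; have := ws i; rewrite tnth_mktuple.
      move=> l li; rewrite memNset// => Al; have := ws l.
      by rewrite tnth_mktuple => /(dA _ _ _ Al) /eqP; rewrite eq_sym (negbTE li).
    rewrite big1// => l _; rewrite memNset// => -[]; exists l.
    by have := ws l; rewrite tnth_mktuple.
  move=> wk.
  (* The cells and their complement partition the space, so the prescribed counts add up to the
     number of nodes. *)
  have Nw : N w = n.
    transitivity (\sum_(j < n.+1) points_in (B j) w)%N.
      rewrite /points_in exchange_big/= -[LHS]card_ord -sum1_card.
      apply: eq_bigr => l _; have [j Bj] := cB (X l w).
      rewrite (bigD1 j)//= mem_set// big1// => j' j'j; rewrite memNset// => Bj'.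
      by move: j'j; rewrite (dB _ _ _ Bj' Bj) eqxx.
    rewrite (eq_bigr k) => [|j _]; last exact: wk.
    rewrite big_ord_recl {1}/k unlift_none add0n.
    rewrite (eq_bigr (fun=> 1%N)) => [|j _]; last by rewrite /k liftK.
    by rewrite sum1_card card_ord.
  have ex i : exists l : 'I_n, A i (X l w).
    have := wk (lift ord0 i); rewrite (points_inE _ Nw) /k /B liftK /= => c1.
    apply/not_existsP => nA; move: c1; rewrite big1// => l _.
    by rewrite memNset.
  have [s As] := choice ex.
  have s_inj : injective s.
    by move=> i j sij; apply: (dA _ _ (X (s i) w)) => //; rewrite sij.
  exists (perm s_inj); split => // i.
  by rewrite tnth_mktuple permE.
rewrite count_independent//; last by move=> i j _ _ [x [Bi Bj]]; exact: dB Bi Bj.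
pose a i := fine (nu (A i)).
have nuA i : nu (A i) = (a i)%:E by rewrite /a fineK// fin_num_measure.
have nurest : nu rest = (1 - \sum_i a i)%R%:E.
  rewrite probability_setC; last exact: measurable_exists_fin.
  rewrite measure_exists_fin// EFinB -sumEFin; congr (_ - _).
  by apply: eq_bigr => i _; exact: nuA.
(* As [nu] has mass one, the rates of the cells and of the complement sum to [rho]: the exponentials
   recombine into [expR (- rho)] whatever the cells are. *)
rewrite big_ord_recl (eq_bigr (fun i => (rho * a i * expR (- (rho * a i)))%R%:E)).
  rewrite count_law// /k /B unlift_none/= nurest/=.
  rewrite expr0 fact0 divr1 mul1r.
  rewrite [in RHS](eq_bigr (fun i => (a i)%:E) (fun i _ => nuA i)).
  rewrite !prodEFin -!EFinM; congr EFin.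
  rewrite !big_split/= prodr_const card_ord -expR_sum sumrN -mulr_sumr.
  set S := (\sum_i a i)%R.
  have -> : expR (- rho) = (expR (- (rho * (1 - S))) * expR (- (rho * S)))%R.
    by rewrite -expRD; congr expR; ring.
  by ring.
move=> i _; rewrite count_law// /k /B liftK/= -/(a i).
by rewrite expr1 (_ : (1`!)%N = 1%N)// divr1.
Qed.

Lemma prob_count n :
  P [set w | N w = n] = (rho ^+ n / n`!%:R * expR (- rho))%R%:E.
Proof.
have := count_law measurableT n; rewrite probability_setT/= mulr1 => <-.
congr (P _); apply/seteqP; split => w /=; rewrite /points_in;
  by rewrite (eq_bigr (fun=> 1%N)) ?sum1_card ?card_ord// => i _; rewrite mem_set.
Qed.

(** For indicator functions both sides are finite measures in the set of tuples, and they agree on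
    separated boxes by [symmetrized_box]. Summing over [s] replaces any assumption on the order in
    which the nodes are listed. *)
Lemma symmetrized_law n (f : n.-tuple E -> \bar R) :
  measurable_fun [set: n.-tuple E] f -> (forall t, 0 <= f t) -> (0 <= rho)%R ->
  \sum_(s : 'S_n) \int[P]_(w in [set w | N w = n]) f (permuted_points s w) =
  (expR (- rho) * rho ^+ n)%R%:E * \int[tuple_power nu n]_t f t.
Proof.
move=> mf f0 rho0.
pose Pn : {measure set T -> \bar R} := mrestr P (measurable_count n).
pose S k := nth 1%g (index_enum {perm 'I_n}) k.
pose m k : {measure set (n.-tuple E) -> \bar R} :=
  measure_function_pushforward__canonical__measure_function_Measure
    Pn (measurable_permuted_points (S k)).
pose M := size (index_enum {perm 'I_n}).
have sumS (F : {perm 'I_n} -> \bar R) : \sum_(k < M) F (S k) = \sum_s F s.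
  by rewrite [RHS](big_nth 1%g) big_mkord.
have mE B : msum m M B =
    \sum_(s : 'S_n) P [set w | N w = n /\ B (permuted_points s w)].
  rewrite -sumS; apply: eq_bigr => k _.
  by rewrite /m /= /pushforward /mrestr setIC.
have c0 : (0 <= expR (- rho) * rho ^+ n)%R.
  by rewrite mulr_ge0 ?expR_ge0 ?exprn_ge0.
pose m' : {measure set (n.-tuple E) -> \bar R} :=
  mscale (NngNum c0) (tuple_power nu n).
(* Every renumbering contributes the probability of [n] nodes, and their number cancels the
   factorial in the Poisson weight. *)
have mT : msum m M setT = m' setT.
  rewrite mE /m' /= /mscale /= probability_setT mule1.
  rewrite (eq_bigr (fun=> (rho ^+ n / n`!%:R * expR (- rho))%R%:E)); last first.
    move=> s _; rewrite -prob_count; congr (P _).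
    by apply/seteqP; split => w //= [].
  rewrite sumEFin sumr_const card_Sn -mulr_natr; congr EFin.
  by field; rewrite pnatr_eq0 -lt0n fact_gt0.
have m'oo : m' setT < +oo.
  by rewrite /m' /= /mscale /= probability_setT mule1 ltry.
have mm' B : measurable B -> msum m M B = m' B.
  apply: (tuple_measure_unique mh) => //.
  - exact: (eq_ind_r (fun x => x < +oo) m'oo mT).
  - by rewrite /m' /= /mscale /= tuple_power_distinct// mule0.
  move=> A mA sA; apply: (etrans (mE _)).
  rewrite symmetrized_box// => [|i j x Ai Aj]; last exact: sA Ai Aj erefl.
  by rewrite /m' /= /mscale /= tuple_power_box.
transitivity (\int[msum m M]_t f t).
  rewrite ge0_integral_measure_sum// -sumS; apply: eq_bigr => k _.
  rewrite ge0_integral_pushforward//; last exact: measurable_permuted_points.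
  rewrite preimage_setT ge0_integral_mrestr//; last by move=> w; exact: f0.
  by apply: measurableT_comp => //; exact: measurable_permuted_points.
transitivity (\int[m']_t f t).
  by apply: eq_measure_integral => B mB _; exact: mm'.
by rewrite /m' ge0_integral_mscale.
Qed.

End poisson_law.

(** * Permutations with one or two prescribed values *)

Section permutation_counting.

(** Composing with a transposition exchanges two possible images of [ord0], so all [n.+1] images are
    equally frequent. *)
Lemma card_perm_at1 n (i : 'I_n.+1) : #|[pred s : 'S_n.+1 | s ord0 == i]| = n`!.
Proof.
pose c k := #|[pred s : 'S_n.+1 | s ord0 == k]|.
have c_const k : c k = c i.
  rewrite /c -!sum1_card (reindex_inj (@mulIg _ (tperm i k)))/=.
  apply: eq_bigl => s; rewrite !inE permM -[X in _ == X](tpermL i k).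
  by rewrite (inj_eq perm_inj).
have : (\sum_k c k = n.+1`!)%N.
  rewrite -card_Sn -sum1_card (partition_big (fun s : 'S_n.+1 => s ord0) predT)//=.
  by apply: eq_bigr => k _; rewrite /c -sum1_card.
rewrite (eq_bigr (fun=> c i)) => [|k _]; last exact: c_const.
rewrite sum_nat_const card_ord factS => /eqP.
by rewrite eqn_pmul2l// => /eqP.
Qed.

Lemma card_perm_at2 n (i k : 'I_n.+2) : i != k ->
  #|[pred s : 'S_n.+2 | (s ord0 == i) && (s (lift ord0 ord0) == k)]| = n`!.
Proof.
move=> ik.
pose o1 : 'I_n.+2 := lift ord0 ord0.
pose c (p : 'I_n.+2 * 'I_n.+2) :=
  #|[pred s : 'S_n.+2 | (s ord0, s o1) == p]|.
have c_const p : p.1 != p.2 -> c p = c (i, k).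
  case: p => i' k' /= i'k'.
  (* The first transposition sends [i] to [i']; the second repairs the image of [k] and leaves [i']
     alone, since it moves neither [i'] nor anything to it. *)
  pose t := (tperm i i' * tperm (tperm i i' k) k')%g.
  have ti : t i = i'.
    rewrite permM tpermL tpermD//; last by rewrite eq_sym.
    by rewrite -[X in _ != X](tpermL i i') (inj_eq perm_inj) eq_sym.
  have tk : t k = k' by rewrite permM tpermL.
  rewrite /c -!sum1_card (reindex_inj (@mulIg _ t))/=.
  apply: eq_bigl => s; rewrite !inE !(permM s t) -ti -tk.
  by rewrite !xpair_eqE !(inj_eq perm_inj).
have : (\sum_(p | p.1 != p.2) c p = n.+2`!)%N.
  rewrite -card_Sn -sum1_card.
  rewrite (partition_big (fun s : 'S_n.+2 => (s ord0, s o1))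
    (fun p => p.1 != p.2))//=; last by move=> s _; rewrite (inj_eq perm_inj).
  by apply: eq_bigr => p _; rewrite /c -sum1_card.
rewrite (eq_bigr (fun=> c (i, k))) => [|p]; last exact: c_const.
rewrite sum_nat_const.
have -> : #|[pred p : 'I_n.+2 * 'I_n.+2 | p.1 != p.2]| = (n.+2 * n.+1)%N.
  have := cardC [pred p : 'I_n.+2 * 'I_n.+2 | p.1 == p.2].
  rewrite card_prod card_ord -[X in (X + _)%N = _]/(#|_|).
  have -> : #|[pred p : 'I_n.+2 * 'I_n.+2 | p.1 == p.2]| = n.+2.
    rewrite -[RHS]card_ord -(card_codom (f := fun i : 'I_n.+2 => (i, i))).
      apply: eq_card => -[a b]; rewrite !inE /=; apply/eqP/codomP.
        by move=> ->; exists b.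
      by move=> [x [-> ->]].
    by move=> a b [].
  rewrite [in RHS]mulnS mulnC => /addnI <-.
  by apply: eq_card.
rewrite !factS mulnA => /eqP; rewrite eqn_pmul2l// => /eqP <-.
by rewrite /c; apply: eq_card => s; rewrite !inE.
Qed.

Lemma sum_perm_at1 (V : nmodType) n (F : 'I_n.+1 -> V) :
  (\sum_(s : 'S_n.+1) F (s ord0) = (\sum_i F i) *+ n`!)%R.
Proof.
rewrite (partition_big (fun s : 'S_n.+1 => s ord0) predT)//= -sumrMnl.
apply: eq_bigr => i _; rewrite -(card_perm_at1 i) -sumr_const.
by apply: eq_bigr => s /eqP ->.
Qed.

Lemma sum_perm_at2 (V : nmodType) n (F : 'I_n.+2 -> 'I_n.+2 -> V) :
  (\sum_(s : 'S_n.+2) F (s ord0) (s (lift ord0 ord0)) =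
  (\sum_i \sum_(k | k != i) F i k) *+ n`!)%R.
Proof.
rewrite pair_big_dep/= -sumrMnl.
rewrite (partition_big (fun s : 'S_n.+2 => (s ord0, s (lift ord0 ord0)))
  (fun p => p.2 != p.1))//=; last by move=> s _; rewrite (inj_eq perm_inj).
apply: eq_bigr => -[i k] /= ki; rewrite -(@card_perm_at2 n i k) 1?eq_sym//.
rewrite -sumr_const; apply: eq_big => s; first by rewrite inE.
by move=> /eqP[-> ->].
Qed.

End permutation_counting.

(** * Mecke formulas for a fixed number of nodes *)

Section mecke.
Local Open Scope ereal_scope.
Context {d dE : measure_display} {T : measurableType d} {E : measurableType dE}
  {R : realType}.
Variables (P : probability T R) (nu : probability E R) (rho : R).
Variables (N : T -> nat) (X : nat -> T -> E).
Hypothesis law : forall n (f : n.-tuple E -> \bar R),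
  measurable_fun [set: n.-tuple E] f -> (forall t, 0 <= f t) ->
  \sum_(s : 'S_n) \int[P]_(w in [set w | N w = n]) f (permuted_points X s w) =
  (expR (- rho) * rho ^+ n)%R%:E * \int[tuple_power nu n]_t f t.

(** The test function treats the first point apart and the others symmetrically. Under a renumbering
    [s] it thus depends on [s ord0] only, and the sum over permutations collapses to a sum over
    nodes, each counted factorial of [n] times. *)
Lemma mecke1 n (u : E -> R) (c : E -> E -> R) :
  measurable_fun setT u -> (forall x, 0 <= u x)%R ->
  measurable_fun setT (fun z : E * E => c z.1 z.2) ->
  (forall x y, 0 <= c x y)%R ->
  n`!%:R%:E * (\sum_(i < n.+1) \int[P]_(w in [set w | N w = n.+1])
    (u (X i w) * \prod_(j < n.+1 | j != i) c (X i w) (X j w))%R%:E) =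
  (expR (- rho) * rho ^+ n.+1)%R%:E *
    \int[nu]_x ((u x)%:E * (\int[nu]_y (c x y)%:E) ^+ n).
Proof.
move=> mu u0 mc c0.
pose f (t : n.+1.-tuple E) : R := (u (tnth t ord0) *
  \prod_(j < n) c (tnth t ord0) (tnth t (lift ord0 j)))%R.
have f0 t : (0 <= f t)%R by rewrite mulr_ge0// prodr_ge0.
have mf : measurable_fun [set: n.+1.-tuple E] f.
  apply: measurable_funM; first by apply: measurableT_comp => //; exact: measurable_tnth.
  apply: measurable_prod => j _.
  apply: (measurableT_comp (f := fun z : E * E => c z.1 z.2)
    (g := fun t : n.+1.-tuple E => (tnth t ord0, tnth t (lift ord0 j)))) => //.
  by apply/measurable_fun_pairP; split; exact: measurable_tnth.
pose F (i : 'I_n.+1) := \int[P]_(w in [set w | N w = n.+1])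
  (u (X i w) * \prod_(j < n.+1 | j != i) c (X i w) (X j w))%R%:E.
transitivity (\sum_(s : 'S_n.+1) F (s ord0)).
  by rewrite sum_perm_at1 mule_natl.
transitivity (\sum_(s : 'S_n.+1) \int[P]_(w in [set w | N w = n.+1])
    (f (permuted_points X s w))%:E).
  apply: eq_bigr => s _; apply: eq_integral => w _; congr EFin.
  rewrite /f !tnth_mktuple; congr (_ * _)%R.
  rewrite (reindex_inj (@perm_inj _ s))/= big_mkcond big_ord_recl eqxx /= mul1r.
  by apply: eq_bigr => j _; rewrite (inj_eq perm_inj) eq_sym neq_lift tnth_mktuple.
rewrite (law (f := fun t => (f t)%:E))//; last exact/measurable_EFinP.
rewrite integral_tuple_powerS//; last exact/measurable_EFinP.
congr (_ * _); apply: eq_integral => x _.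
have mcx : measurable_fun [set: E] (c x).
  exact: (measurable_fun_pair2 x mc).
rewrite -(integral_tuple_power_prod nu n mcx (c0 x)) -ge0_integralZl//.
- apply: eq_integral => t _; rewrite -EFinM /f tnth0; congr (_ * _)%R%:E.
  by apply: eq_bigr => j _; rewrite tnthS.
- by apply/measurable_EFinP; exact: measurable_prod_tnth.
- by move=> t _; rewrite lee_fin; exact: prodr_ge0.
- by rewrite lee_fin.
Qed.

(** Same collapse as for one node, with an ordered pair of distinct nodes put in the first two
    places. *)
Lemma mecke2 n (u : E -> E -> R) (c : E -> E -> E -> R) :
  measurable_fun setT (fun z : E * E => u z.1 z.2) ->
  (forall x y, 0 <= u x y)%R ->
  measurable_fun setT (fun z : E * E * E => c z.1.1 z.1.2 z.2) ->
  (forall x y z, 0 <= c x y z)%R ->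
  n`!%:R%:E * (\sum_(i < n.+2) \sum_(k < n.+2 | k != i)
    \int[P]_(w in [set w | N w = n.+2]) (u (X i w) (X k w) *
      \prod_(j < n.+2 | (j != i) && (j != k)) c (X i w) (X k w) (X j w))%R%:E) =
  (expR (- rho) * rho ^+ n.+2)%R%:E *
    \int[nu]_x \int[nu]_y ((u x y)%:E * (\int[nu]_z (c x y z)%:E) ^+ n).
Proof.
move=> mu u0 mc c0.
pose o1 : 'I_n.+2 := lift ord0 ord0.
pose f (t : n.+2.-tuple E) : R := (u (tnth t ord0) (tnth t o1) *
  \prod_(j < n) c (tnth t ord0) (tnth t o1) (tnth t (lift ord0 (lift ord0 j))))%R.
have f0 t : (0 <= f t)%R by rewrite mulr_ge0// prodr_ge0.
have mpair (i j : 'I_n.+2) : measurable_fun [set: n.+2.-tuple E]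
    (fun t : n.+2.-tuple E => (tnth t i, tnth t j)).
  by apply/measurable_fun_pairP; split; exact: measurable_tnth.
have mf : measurable_fun [set: n.+2.-tuple E] f.
  apply: measurable_funM.
    exact: (measurableT_comp (f := fun z : E * E => u z.1 z.2)
      (g := fun t : n.+2.-tuple E => (tnth t ord0, tnth t o1))).
  apply: measurable_prod => j _.
  apply: (measurableT_comp (f := fun z : E * E * E => c z.1.1 z.1.2 z.2)
    (g := fun t : n.+2.-tuple E => ((tnth t ord0, tnth t o1),
       tnth t (lift ord0 (lift ord0 j))))) => //.
  by apply/measurable_fun_pairP; split; [exact: mpair|exact: measurable_tnth].
pose F (i k : 'I_n.+2) := \int[P]_(w in [set w | N w = n.+2])
  (u (X i w) (X k w) *
   \prod_(j < n.+2 | (j != i) && (j != k)) c (X i w) (X k w) (X j w))%R%:E.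
transitivity (\sum_(s : 'S_n.+2) F (s ord0) (s o1)).
  by rewrite sum_perm_at2 mule_natl.
transitivity (\sum_(s : 'S_n.+2) \int[P]_(w in [set w | N w = n.+2])
    (f (permuted_points X s w))%:E).
  apply: eq_bigr => s _; apply: eq_integral => w _; congr EFin.
  rewrite /f !tnth_mktuple; congr (_ * _)%R.
  rewrite (reindex_inj (@perm_inj _ s))/= big_mkcond big_ord_recl eqxx /= mul1r.
  rewrite big_ord_recl eqxx andbF /= mul1r.
  by apply: eq_bigr => j _; rewrite !(inj_eq perm_inj) tnth_mktuple.
rewrite (law (f := fun t => (f t)%:E))//; last exact/measurable_EFinP.
rewrite integral_tuple_powerS//; last exact/measurable_EFinP.
congr (_ * _); apply: eq_integral => x _.
have mfx : measurable_fun [set: n.+1.-tuple E] (fun t => f [tuple of x :: t]).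
  apply: (measurableT_comp mf).
  exact: (@measurable_cons _ _ _ _ (cst x) n.+1 id).
rewrite (@integral_tuple_powerS _ _ _ nu n (fun t => (f [tuple of x :: t])%:E)); first last.
- by move=> t; rewrite lee_fin.
- exact/measurable_EFinP.
apply: eq_integral => y _.
have mcxy : measurable_fun [set: E] (c x y).
  exact: (measurable_fun_pair2 (x, y) mc).
rewrite -(integral_tuple_power_prod nu n mcxy (c0 x y)) -ge0_integralZl//.
- apply: eq_integral => t _; rewrite -EFinM /f tnth0 !tnthS tnth0.
  congr (_ * _)%R%:E.
  by apply: eq_bigr => j _; rewrite !tnthS.
- by apply/measurable_EFinP; exact: measurable_prod_tnth.
- by move=> t _; rewrite lee_fin; exact: prodr_ge0.
- by rewrite lee_fin.
Qed.

End mecke.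

(** Each other node [j] forms exactly one ordered pair with [i]; the two halves are those where [i]
    is the smaller and the larger end. *)
Lemma prod_incident (R : comRingType) n (i : 'I_n) (d : 'I_n -> 'I_n -> R) :
  (forall a b, d a b = d b a) ->
  \prod_(ab : 'I_n * 'I_n | (ab.1 < ab.2)%N && ((ab.1 == i) || (ab.2 == i)))
    d ab.1 ab.2 = \prod_(j < n | j != i) d i j.
Proof.
move=> dC; rewrite (bigID (fun ab => ab.1 == i))/=.
rewrite [RHS](bigID (fun j : 'I_n => (i < j)%N))/=; congr (_ * _).
  rewrite (reindex_onto (fun j => (i, j)) snd)/=; last first.
    by move=> [a b] /= /andP[_ /eqP ->].
  apply: eq_bigl => j; rewrite !eqxx /= !andbT.
  by rewrite neq_ltn; case: ltngtP.
rewrite (reindex_onto (fun j => (j, i)) fst)/=; last first.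
  by move=> [a b] /= /andP[/andP[_ /orP[->//|/eqP ->]]].
apply: eq_big => [j|j _]; last exact: dC.
by rewrite !eqxx orbT !andbT -!val_eqE /=; case: ltngtP.
Qed.

Lemma measurable_prod_cond d (T : measurableType d) (R : realType) (D : set T)
    (I : finType) (Q : pred I) (h : I -> T -> R) :
  (forall i, Q i -> measurable_fun D (h i)) ->
  measurable_fun D (fun x => \prod_(i | Q i) h i x).
Proof.
move=> mh; under eq_fun do rewrite -big_filter.
by apply: measurable_prod => i; rewrite mem_filter => /andP[Qi _]; exact: mh.
Qed.

(** * Isolation probabilities given the positions *)

Section isolated_nodes.
Context {R : realType} {d : measure_display} {T : measurableType d}.
Variables (P : probability T R) (f : R -> R) (G : network R T).
Hypothesis mN : measurable_fun [set: T] (node_count G).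
Hypothesis mX : forall i, measurable_fun [set: T] (position G i).
Hypothesis mf : measurable_fun [set: R * R] (fun z => f (euclid_norm z)).
Hypothesis f01 : forall x, 0 <= x -> 0 <= f x <= 1.
Hypothesis edges : independent_edges P f G.

Let p (x y : R * R) : R := f (euclid_norm (x - y)).

Let p01 x y : 0 <= p x y <= 1.
Proof. by apply: f01; exact: sqrtr_ge0. Qed.

Let incident n (K : {set 'I_n}) (ab : 'I_n * 'I_n) : bool :=
  (ab.1 \in K) || (ab.2 \in K).

(* The sum over all edge sets with no edge incident to [K] factors over pairs. *)
Lemma sum_edge_weight_isolated n (K : {set 'I_n}) (x : n.-tuple (R * R)) :
  \sum_(h in pfamily false [pred ab : 'I_n * 'I_n | (ab.1 < ab.2)%N]
      (fun ab => [pred b | incident K ab ==> ~~ b]))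
    edge_weight f (fun i j => h (i, j)) x =
  \prod_(ab : 'I_n * 'I_n | (ab.1 < ab.2)%N && incident K ab)
    (1 - p (tnth x ab.1) (tnth x ab.2)).
Proof.
pose F (ab : 'I_n * 'I_n) (b : bool) :=
  let q := p (tnth x ab.1) (tnth x ab.2) in if b then q else 1 - q.
transitivity (\sum_(h in pfamily false [pred ab : 'I_n * 'I_n | (ab.1 < ab.2)%N]
      (fun ab => [pred b | incident K ab ==> ~~ b]))
    \prod_(ab : 'I_n * 'I_n | (ab.1 < ab.2)%N) F ab (h ab)).
  apply: eq_bigr => h _; apply: eq_bigr => -[a b] _ //.
rewrite -big_distr_big_dep/= [RHS]big_mkcondr; apply: eq_bigr => ab _.
(* A pair away from [K] contributes [q + (1 - q) = 1], a pair that meets [K] only [1 - q]. *)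
rewrite big_mkcond big_bool /F/= implybT implybF.
by case: incident; rewrite /= ?add0r// addrC subrK.
Qed.

Lemma measurable_connection (Y Z : T -> R * R) :
  measurable_fun [set: T] Y -> measurable_fun [set: T] Z ->
  measurable_fun [set: T] (fun w => p (Y w) (Z w)).
Proof.
move=> mY mZ; apply: (measurableT_comp mf).
apply/measurable_fun_pairP; split.
  by apply: (measurable_funB (f := fst \o Y) (g := fst \o Z));
    exact: measurableT_comp.
by apply: (measurable_funB (f := snd \o Y) (g := snd \o Z));
  exact: measurableT_comp.
Qed.

Lemma measurable_positions n : measurable_fun [set: T] (positions G n).
Proof.
apply/measurable_fun_tnthP => i.
rewrite (_ : _ \o _ = position G i)//.
by apply/funext => w; rewrite /= tnth_mktuple.
Qed.

Lemma measurable_count_positions n (B : set (n.-tuple (R * R))) : measurable B ->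
  measurable [set w | node_count G w = n /\ B (positions G n w)].
Proof.
move=> mB; apply: measurableI; first exact: measurable_count.
by rewrite -[X in measurable X]setTI; exact: measurable_positions.
Qed.

Lemma measurable_edge i j b : measurable [set w | edge G i j w = b].
Proof.
have [me _ _ _] := edges.
by have := me i j measurableT [set b] I; rewrite setTI.
Qed.

(** The hypothesis on edges gives the probability of complete edge sets only, so the event is cut
    into the graphs without edges at [K]. Membership in [pfamily] forces [false] off the pairs
    [a < b], which leaves one function per graph and makes the union disjoint. *)
Lemma prob_isolated n (K : {set 'I_n}) (B : set (n.-tuple (R * R))) :
  measurable B ->
  let D := [set w | node_count G w = n /\ B (positions G n w)] in
  P (D `&` [set w | forall i j : 'I_n, i \in K -> ~~ edge G i j w]) =
  (\int[P]_(w in D) (\prod_(ab : 'I_n * 'I_n | (ab.1 < ab.2)%N && incident K ab)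
    (1 - p (position G ab.1 w) (position G ab.2 w)))%:E)%E.
Proof.
move=> mB D; have [_ eC eI ew] := edges.
pose lt_pair := [pred ab : 'I_n * 'I_n | (ab.1 < ab.2)%N].
pose H := pfamily false lt_pair
  (fun ab => [pred b | incident K ab ==> ~~ b]).
pose F (h : {ffun 'I_n * 'I_n -> bool}) := if h \in H then
  D `&` [set w | forall i j : 'I_n, (i < j)%N -> edge G i j w = h (i, j)]
  else set0.
have mD : measurable D by exact: measurable_count_positions.
have mF h : measurable (F h).
  rewrite /F; case: ifP => // _; apply: measurableI => //.
  apply: (measurable_forall_fin (F := fun i : 'I_n =>
    [set w | forall j : 'I_n, (i < j)%N -> edge G i j w = h (i, j)])) => i.
  apply: (measurable_forall_fin (F := fun j : 'I_n =>
    [set w | (i < j)%N -> edge G i j w = h (i, j)])) => j.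
  case: ltnP => _.
    rewrite (_ : mkset _ = [set w | edge G i j w = h (i, j)]).
      exact: measurable_edge.
    by apply/seteqP; split => w /=; [exact|].
  by rewrite (_ : mkset _ = setT)//; apply/seteqP; split.
have -> : D `&` [set w | forall i j : 'I_n, i \in K -> ~~ edge G i j w] =
    [set w | exists h, F h w].
  apply/seteqP; split => w /=.
    move=> [Dw Kw].
    exists [ffun ab => lt_pair ab && edge G ab.1 ab.2 w].
    rewrite /F ifT; last first.
      apply/pfamilyP; split.
        by apply/supportP => ab /negbTE; rewrite ffunE /in_mem /= => ->.
      move=> [a b] /= ab; rewrite inE ffunE /= [(a < b)%N]ab /=.
      apply/implyP => /orP[aK|bK]; first exact: Kw.
      by rewrite eC; exact: Kw.
    by split => // i j ij; rewrite ffunE /= ij.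
  move=> [h]; rewrite /F; case: ifP => // /pfamilyP[_ hK] [Dw hw]; split => // i j iK.
  have [ij|ji|/ord_inj ->] := ltngtP i j.
  - rewrite hw//; have := hK (i, j) ij.
    by rewrite inE /incident /= iK.
  - rewrite eC hw//; have := hK (j, i) ji.
    by rewrite inE /incident /= iK orbT.
  - exact: eI.
rewrite (measure_exists_fin P)//; last first.
  move=> h h' w; rewrite /F; case: ifP => // /pfamilyP[/supportP h0 _] [_ hw].
  case: ifP => // /pfamilyP[/supportP h'0 _] [_ h'w].
  apply/ffunP => -[a b]; have [ab|nab] := boolP ((a, b) \in lt_pair).
    by rewrite -hw// -h'w.
  by rewrite h0// h'0.
transitivity (\sum_(h in H) \int[P]_(w in D)
    (edge_weight f (fun i j => h (i, j)) (positions G n w))%:E)%E.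
  rewrite [RHS]big_mkcond; apply: eq_bigr => h _; rewrite /F; case: ifP => _.
    exact: ew.
  exact: measure0.
rewrite -big_filter -ge0_integral_sum//.
- apply: eq_integral => w _; rewrite big_filter sumEFin sum_edge_weight_isolated.
  by congr EFin; apply: eq_bigr => ab _; rewrite !tnth_mktuple.
- move=> h; apply/measurable_EFinP; apply: measurable_funTS.
  apply: measurable_prod_cond => ab _ /=.
  rewrite (_ : (fun x => _) = if h (ab.1, ab.2)
     then fun w => p (position G ab.1 w) (position G ab.2 w)
     else fun w => 1 - p (position G ab.1 w) (position G ab.2 w)); last first.
    by apply/funext => w; rewrite /= !tnth_mktuple; case: ifP.
  case: ifP => _; first exact: measurable_connection.
  by apply: measurable_funB => //; exact: measurable_connection.
- move=> h w _; rewrite lee_fin; apply: prodr_ge0 => ab _ /=.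
  have /andP[p0 p1] := p01 (tnth (positions G n w) ab.1) (tnth (positions G n w) ab.2).
  by case: ifP => // _; rewrite subr_ge0.
Qed.

End isolated_nodes.

(** When [m > 0] of the events occur, the pointwise inequality amounts to [0 <= (1 - t * m) ^+ 2],
    since the double sum counts [m ^+ 2 - m] ordered pairs; when none occurs, both sides vanish. *)
Lemma second_moment_events d (T : measurableType d) (R : realType)
    (P : probability T R) n (F : 'I_n -> set T) (t : R) :
  (forall i, measurable (F i)) -> 0 <= t <= 2 ->
  ((t * (2 - t))%:E * (\sum_i P (F i)) <=
   P [set w | exists i, F i w] +
   (t ^+ 2)%:E * \sum_i \sum_(k | k != i) P (F i `&` F k))%E.
Proof.
move=> mF /andP[t0 t2].
have tt0 : 0 <= t * (2 - t) by rewrite mulr_ge0// subr_ge0.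
have mU : measurable [set w | exists i, F i w] by exact: measurable_exists_fin.
have mI i k : measurable (F i `&` F k) by exact: measurableI.
have mF1 i : measurable_fun [set: T] (\1_(F i) : T -> R).
  exact: measurable_indic.
have mI1 i k : measurable_fun [set: T] (\1_(F i `&` F k) : T -> R).
  exact: measurable_indic.
have intP A : measurable A -> P A = (\int[P]_w (\1_A w)%:E)%E.
  by move=> mA; rewrite integral_indic// setIT.
have integralZ (c : R) (g : T -> R) : 0 <= c -> measurable_fun [set: T] g ->
    (forall w, 0 <= g w) ->
    (c%:E * \int[P]_w (g w)%:E = \int[P]_w (c * g w)%:E)%E.
  move=> c0 mg g0; rewrite -ge0_integralZl//.
  - exact/measurable_EFinP.
  - by move=> w _; rewrite lee_fin.
have integralD (g1 g2 : T -> R) : measurable_fun [set: T] g1 ->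
    (forall w, 0 <= g1 w) -> measurable_fun [set: T] g2 ->
    (forall w, 0 <= g2 w) ->
    (\int[P]_w (g1 w)%:E + \int[P]_w (g2 w)%:E = \int[P]_w (g1 w + g2 w)%:E)%E.
  move=> mg1 g10 mg2 g20; rewrite -ge0_integralD//.
  - by move=> w _; rewrite lee_fin.
  - exact/measurable_EFinP.
  - by move=> w _; rewrite lee_fin.
  - exact/measurable_EFinP.
have -> : (\sum_i P (F i) = \int[P]_w (\sum_i \1_(F i) w)%:E)%E.
  under [RHS]eq_integral do rewrite -sumEFin.
  rewrite ge0_integral_sum//; first by apply: eq_bigr => i _; rewrite intP.
  by move=> i; apply/measurable_EFinP; exact: mF1.
have -> : (\sum_i \sum_(k | k != i) P (F i `&` F k) =
    \int[P]_w (\sum_i \sum_(k | k != i) \1_(F i `&` F k) w)%:E)%E.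
  under [RHS]eq_integral do rewrite -sumEFin.
  rewrite ge0_integral_sum//; last 2 first.
  - move=> i; apply/measurable_EFinP; under eq_fun do rewrite -big_filter.
    by apply: measurable_sum => k; exact: mI1.
  - by move=> i w _; rewrite lee_fin sumr_ge0.
  apply: eq_bigr => i _; rewrite -big_filter.
  under [RHS]eq_integral do rewrite -big_filter -sumEFin.
  rewrite ge0_integral_sum//; first by apply: eq_bigr => k _; rewrite intP.
  by move=> k; apply/measurable_EFinP; exact: mI1.
have m1 : measurable_fun [set: T] (fun w => \sum_i \1_(F i) w : R).
  by apply: measurable_sum => i; exact: mF1.
have m2 : measurable_fun [set: T]
    (fun w => \sum_i \sum_(k | k != i) \1_(F i `&` F k) w : R).
  apply: measurable_sum => i; under eq_fun do rewrite -big_filter.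
  by apply: measurable_sum => k; exact: mI1.
have s1 w : 0 <= \sum_i \1_(F i) w :> R by exact: sumr_ge0.
have s2 w : 0 <= \sum_i \sum_(k | k != i) \1_(F i `&` F k) w :> R.
  by do 2 (apply: sumr_ge0 => ? _).
rewrite intP// !integralZ ?sqr_ge0// integralD//; last 2 first.
- exact: measurable_funM.
- by move=> w; rewrite mulr_ge0// sqr_ge0.
apply: ge0_le_integral => //.
- by move=> w _; rewrite lee_fin mulr_ge0// sumr_ge0.
- by apply/measurable_EFinP; exact: measurable_funM.
- by apply/measurable_EFinP; apply: measurable_funD; [exact: measurable_indic|exact: measurable_funM].
move=> w _; rewrite lee_fin.
set m := \sum_i \1_(F i) w.
have indI i k : \1_(F i `&` F k) w = \1_(F i) w * \1_(F k) w :> R.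
  by rewrite indicI.
have -> : \sum_i \sum_(k | k != i) \1_(F i `&` F k) w = m ^+ 2 - m.
  have -> : m ^+ 2 = \sum_i \sum_k \1_(F i) w * \1_(F k) w.
    rewrite expr2 /m big_distrl/=; apply: eq_bigr => i _.
    by rewrite big_distrr.
  rewrite /m -sumrB; apply: eq_bigr => i _.
  rewrite [in RHS](bigD1 i)//= -indI setIid addrAC subrr add0r.
  by apply: eq_bigr => k _; rewrite indI.
have [[i Fi]|nF] := pselect (exists i, F i w).
  rewrite indicE mem_set/=; last by exists i.
  have := sqr_ge0 (1 - t * m); nra.
have -> : m = 0.
  apply: big1 => i _; rewrite indicE memNset// => Fi.
  by apply: nF; exists i.
by rewrite indicE memNset//=; lra.
Qed.

(** The generating function of the Poisson law: here the probability [q ^+ n] that [n] independent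
    nodes all avoid a point becomes an exponential. *)
Lemma poisson_generating (R : realType) (rho u q : R) :
  0 <= rho -> 0 <= u -> 0 <= q ->
  (\sum_(n <oo) (u * (expR (- rho) * rho ^+ n / n`!%:R) * q ^+ n)%:E =
   (u * expR (- (rho * (1 - q))))%:E)%E.
Proof.
move=> rho0 u0 q0.
have -> : (fun n => \sum_(0 <= i < n)
      (u * (expR (- rho) * rho ^+ i / i`!%:R) * q ^+ i)%:E)%E =
    EFin \o (fun n => (u * expR (- rho)) * series (exp_coeff (rho * q)) n).
  apply/funext => n /=; rewrite sumEFin /series /= big_distrr/=.
  congr EFin; apply: eq_bigr => i _.
  by rewrite /exp_coeff /= exprMn; ring.
set c := u * expR (- rho).
have cvgM : (c * series (exp_coeff (rho * q)) n)%R @[n --> \oo] -->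
    c * expR (rho * q).
  by apply: cvgMr; exact: is_cvg_series_exp_coeff.
rewrite EFin_lim; last by apply/cvg_ex; exists (c * expR (rho * q)).
rewrite (cvg_lim _ cvgM)// /c -mulrA -expRD; congr (_ * expR _)%:E; ring.
Qed.

(** The pair formed by [i] and [k] has a factor at most one, which is dropped. What remains is a
    product over the other nodes, each entering on its own, as the second Mecke formula requires. *)
Lemma prod_incident2_le (R : realDomainType) n (i k : 'I_n) (d : 'I_n -> 'I_n -> R) :
  k != i -> (forall a b, d a b = d b a) -> (forall a b, 0 <= d a b <= 1) ->
  \prod_(ab : 'I_n * 'I_n | (ab.1 < ab.2)%N &&
     ((ab.1 \in [set i; k]%SET) || (ab.2 \in [set i; k]%SET))) d ab.1 ab.2 <=
  \prod_(j < n | (j != i) && (j != k)) (d i j * d k j).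
Proof.
move=> ki dC d01.
have d0 a b : 0 <= d a b by have /andP[] := d01 a b.
have d1 a b : d a b <= 1 by have /andP[] := d01 a b.
rewrite (bigID (fun ab : 'I_n * 'I_n => (ab.1 == i) || (ab.2 == i)))/=.
rewrite (eq_bigl (fun ab : 'I_n * 'I_n =>
  (ab.1 < ab.2)%N && ((ab.1 == i) || (ab.2 == i)))); last first.
  by move=> [a b] /=; rewrite !inE; case: (a == i); case: (b == i); case: (a == k);
     case: (b == k); rewrite ?andbT ?andbF.
rewrite prod_incident// big_split/=; apply: ler_pM.
- exact: prodr_ge0.
- exact: prodr_ge0.
- rewrite (bigD1 k)//= ler_piMl//; exact: prodr_ge0.
(* Pairs through [i] are already accounted for; giving them the factor 1 lets [prod_incident] apply
   to all pairs through [k]. *)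
pose d' a b := if (a == i) || (b == i) then 1 else d a b.
rewrite (eq_bigl (fun ab : 'I_n * 'I_n =>
  ((ab.1 < ab.2)%N && ((ab.1 == k) || (ab.2 == k))) && ~~ ((ab.1 == i) || (ab.2 == i)))); last first.
  by move=> [a b] /=; rewrite !inE; case: (a == i); case: (b == i); case: (a == k);
     case: (b == k); rewrite ?andbT ?andbF.
rewrite big_mkcondr/= (eq_bigr (fun ab => d' ab.1 ab.2)) => [|ab _]; last first.
  by rewrite /d'; case: ((ab.1 == i) || (ab.2 == i)).
rewrite prod_incident; last by move=> a b; rewrite /d' orbC dC.
rewrite [leRHS](eq_bigl (fun j => (j != k) && (j != i))) => [|j]; last by rewrite andbC.
rewrite [leRHS]big_mkcondr/=; apply: ler_prod => j jk.
rewrite /d' (negbTE ki)/=; case: eqP => _ /=; first by rewrite ler01 lexx.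
by rewrite d0 lexx.
Qed.

Lemma integral_setI_indic d (T : measurableType d) (R : realType)
    (mu : {measure set T -> \bar R}) (D E : set T) (g : T -> R) :
  measurable D -> measurable E ->
  (\int[mu]_(w in D `&` E) (g w)%:E = \int[mu]_(w in D) (\1_E w * g w)%:E)%E.
Proof.
move=> mD mE; rewrite integral_mkcond [RHS]integral_mkcond.
apply: eq_integral => w _; rewrite /patch indicE in_setI.
by case: (w \in D); case: (w \in E); rewrite //= ?mul1r// mul0r.
Qed.

(** * Events of isolation inside a region *)

Section isolated_moments.
Context {R : realType} {d : measure_display} {T : measurableType d}.
Variables (P : probability T R) (f : R -> R) (G : network R T).
Hypothesis mN : measurable_fun [set: T] (node_count G).
Hypothesis mX : forall i, measurable_fun [set: T] (position G i).
Hypothesis mf : measurable_fun [set: R * R] (fun z => f (euclid_norm z)).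
Hypothesis f01 : forall x, 0 <= x -> 0 <= f x <= 1.
Hypothesis edges : independent_edges P f G.
Variables (A : set (R * R)) (mA : measurable A).

Definition unlinked (x y : R * R) : R := 1 - f (euclid_norm (x - y)).

Lemma euclid_normN (z : R * R) : euclid_norm (- z) = euclid_norm z.
Proof. by rewrite /euclid_norm /= !sqrrN. Qed.

Lemma unlinkedC x y : unlinked x y = unlinked y x.
Proof. by rewrite /unlinked -[x - y]opprB euclid_normN. Qed.

Lemma unlinked01 x y : 0 <= unlinked x y <= 1.
Proof.
have /andP[] := f01 (sqrtr_ge0 _ : 0 <= euclid_norm (x - y)).
by rewrite /unlinked => f0 f1; apply/andP; split; lra.
Qed.

(** The number of nodes is part of the event, so that events for different [n] are disjoint and
    their probabilities can be added. *)
Definition isolated n (i : 'I_n) : set T :=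
  [set w | [/\ node_count G w = n, A (position G i w) &
    forall j : 'I_n, ~~ edge G i j w]].

Let count_is n : set T := [set w | node_count G w = n].

Let mposA i : measurable (position G i @^-1` A).
Proof. by rewrite -[_ @^-1` _]setTI; exact: mX. Qed.

Lemma measurable_isolated n (i : 'I_n) : measurable (isolated i).
Proof.
rewrite (_ : isolated i = count_is n `&` (position G i @^-1` A `&`
    [set w | forall j : 'I_n, edge G i j w = false])); last first.
  apply/seteqP; split => w /=.
    by move=> [Nw Aw ew]; split => //; split => // j; apply/negbTE.
  by move=> [Nw [Aw ew]]; split => // j; rewrite ew.
apply: measurableI; first exact: measurable_count.
apply: measurableI => //.
by apply: measurable_forall_fin => j; exact: (measurable_edge edges).
Qed.

Lemma prob_isolated1 n (i : 'I_n) :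
  P (isolated i) = (\int[P]_(w in count_is n) (\1_A (position G i w) *
    \prod_(j < n | j != i) unlinked (position G i w) (position G j w))%:E)%E.
Proof.
have mB : measurable [set t : n.-tuple (R * R) | A (tnth t i)].
  exact: measurable_tnth_preimage.
have /= := prob_isolated mN mX mf f01 edges [set i]%SET mB.
rewrite (_ : _ `&` _ = isolated i); last first.
  apply/seteqP; split => w /=; rewrite tnth_mktuple.
    by move=> [[Nw Aw] ew]; split => // j; apply: ew; rewrite inE.
  by move=> [Nw Aw ew]; split => // i' j; rewrite inE => /eqP ->.
move=> ->; rewrite (_ : mkset _ = count_is n `&` position G i @^-1` A); last first.
  by apply/seteqP; split => w /=; rewrite tnth_mktuple.
under eq_integral => w _.
  rewrite (eq_bigl (fun ab : 'I_n * 'I_n =>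
      (ab.1 < ab.2)%N && ((ab.1 == i) || (ab.2 == i)))); last first.
    by move=> ab; rewrite !inE.
  rewrite (prod_incident i (d := fun a b : 'I_n =>
    unlinked (position G a w) (position G b w))); last by move=> *; exact: unlinkedC.
  over.
by rewrite integral_setI_indic//; exact: measurable_count.
Qed.

Lemma prob_isolated2 n (i k : 'I_n) : k != i ->
  (P (isolated i `&` isolated k) <= \int[P]_(w in count_is n)
   (\1_A (position G i w) * \1_A (position G k w) *
    \prod_(j < n | (j != i) && (j != k))
      (unlinked (position G i w) (position G j w) *
       unlinked (position G k w) (position G j w)))%:E)%E.
Proof.
move=> ki.
have mB : measurable [set t : n.-tuple (R * R) | A (tnth t i) /\ A (tnth t k)].
  by apply: measurableI; exact: measurable_tnth_preimage.
have /= := prob_isolated mN mX mf f01 edges [set i; k]%SET mB.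
rewrite (_ : _ `&` _ = isolated i `&` isolated k); last first.
  apply/seteqP; split => w /=; rewrite !tnth_mktuple.
    by move=> [[Nw [Ai Ak]] ew]; split; split => // j; apply: ew; rewrite !inE eqxx ?orbT.
  by move=> [[Nw Ai ei] [_ Ak ek]]; split => // i' j; rewrite !inE => /orP[] /eqP ->.
move=> ->; rewrite (_ : mkset _ = count_is n `&`
    (position G i @^-1` A `&` position G k @^-1` A)); last first.
  by apply/seteqP; split => w /=; rewrite !tnth_mktuple.
have mpi a b : measurable_fun [set: T] (fun w => unlinked (position G a w) (position G b w)).
  by apply: measurable_funB => //; exact: (measurable_connection mf).
rewrite integral_setI_indic//; last 2 first.
- exact: measurable_count.
- exact: measurableI.
apply: ge0_le_integral => //.
- exact: measurable_count.
- move=> w _; rewrite lee_fin mulr_ge0//; apply: prodr_ge0 => ab _.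
  by have /andP[] := unlinked01 (position G ab.1 w) (position G ab.2 w).
- apply/measurable_EFinP; apply: measurable_funTS; apply: measurable_funM.
    by apply: measurable_indic; exact: measurableI.
  by apply: measurable_prod_cond => ab _; exact: mpi.
- apply/measurable_EFinP; apply: measurable_funTS; apply: measurable_funM.
    by apply: measurable_funM; apply: measurableT_comp => //; exact: measurable_indic.
  by apply: measurable_prod_cond => ab _; apply: measurable_funM; exact: mpi.
move=> w _; rewrite lee_fin indicI /=; apply: ler_wpM2l.
  by rewrite mulr_ge0.
apply: (prod_incident2_le (d := fun a b : 'I_n =>
  unlinked (position G a w) (position G b w))) => // [a b|a b].
  exact: unlinkedC.
exact: unlinked01.
Qed.

End isolated_moments.

(** * Connectivity as an event *)

Section connectivity.
Context {R : realType} {d : measure_display} {T : measurableType d}.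
Variables (P : probability T R) (f : R -> R) (G : network R T).
Hypothesis mN : measurable_fun [set: T] (node_count G).
Hypothesis edges : independent_edges P f G.

Let connected_on n (w : T) : Prop :=
  forall i j : 'I_n, connect (fun k l : 'I_n => edge G k l w) i j.

Lemma measurable_connected : measurable [set w | is_connected G w].
Proof.
have mC n : measurable [set w | connected_on n w].
  (* Connectivity on [n] nodes depends on a finite graph only, so the event is a finite union of
     events that prescribe the graph. *)
  pose graph_is (h : {ffun 'I_n * 'I_n -> bool}) : set T :=
    [set w | forall k : 'I_n * 'I_n, edge G k.1 k.2 w = h k].
  pose good (h : {ffun 'I_n * 'I_n -> bool}) : Prop :=
    forall i j : 'I_n, connect (fun k l : 'I_n => h (k, l)) i j.
  rewrite (_ : mkset _ = [set w | exists h, (if pselect (good h)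
      then graph_is h else set0) w]); last first.
    apply/seteqP; split => w /=.
      move=> cw; exists [ffun k : 'I_n * 'I_n => edge G k.1 k.2 w].
      case: pselect => [_ k|[]]; first by rewrite ffunE.
      move=> i j; have := cw i j; congr is_true; apply: eq_connect => k l /=.
      by rewrite ffunE.
    move=> [h]; case: pselect => // gh hw i j; have := gh i j; congr is_true.
    by apply: eq_connect => k l; rewrite -(hw (k, l)).
  apply: measurable_exists_fin => h; case: (pselect (good h)) => gh; last exact: measurable0.
  apply: measurable_forall_fin => k.
  exact: (measurable_edge edges).
rewrite (_ : mkset _ =
    \bigcup_n ([set w | node_count G w = n] `&` [set w | connected_on n w])).
  by apply: bigcupT_measurable => n; apply: measurableI; [exact: measurable_count|exact: mC].
apply/seteqP; split => w; first by move=> cw; exists (node_count G w).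
by move=> [n _ [/= <-]].
Qed.

(** The index type ['I_n.+2] rules out the network with a single node, which is connected although
    its node is isolated. *)
Lemma isolated_not_connected (A : set (R * R)) n (i : 'I_n.+2) w :
  isolated G A i w -> ~ is_connected G w.
Proof.
move=> [Nw _ ew] cw.
have {cw}cw : connected_on n.+2 w by rewrite -Nw.
have [j ji] : exists j : 'I_n.+2, j != i.
  by exists (lift i ord0); rewrite eq_sym neq_lift.
have /connectP[[|k s] /= path_s jE] := cw i j; first by rewrite jE eqxx in ji.
by move: path_s; rewrite (negbTE (ew k)).
Qed.

End connectivity.

(** * Moments of the number of isolated nodes *)

Section moment_bound.
Local Open Scope ereal_scope.
Context {R : realType} {d : measure_display} {T : measurableType d}.
Variables (P : probability T R) (rho : R) (f : R -> R) (G : network R T).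
Variables (nu : probability (R * R)%type R) (A : set (R * R)) (t : R).
Hypothesis rho0 : (0 <= rho)%R.
Hypothesis mf : measurable_fun [set: R * R] (fun z => f (euclid_norm z)).
Hypothesis f01 : forall x, (0 <= x)%R -> (0 <= f x <= 1)%R.
Hypothesis nuE : forall B : set (R * R), measurable B ->
  nu B = plane_measure (B `&` unit_square).
Hypothesis nu_line : forall a : R, nu (fst @^-1` [set a]) = 0.
Hypothesis mA : measurable A.
Hypothesis t02 : (0 <= t <= 2)%R.
Hypothesis G_rcn : random_connection_network P rho f G.

Definition avoid1 (x : R * R) : R := fine (\int[nu]_y (unlinked f x y)%:E).
Definition avoid2 (x y : R * R) : R :=
  fine (\int[nu]_z (unlinked f x z * unlinked f y z)%:E).

(** All nodes lie in the square. The count laws, given for subsets of the square, thereby extend to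
    all measurable sets of the plane, where [nu] lives. *)
Lemma points_inE_nodes (B : set (R * R)) w :
  points_in (node_count G) (position G) B w = nodes_in G (B `&` unit_square) w.
Proof.
have [[_ _ inS _ _] _] := G_rcn.
apply: eq_bigr => i _; rewrite in_setI (mem_set (inS w i _)) ?andbT//.
Qed.

Lemma measurable_unit_square : measurable (@unit_square R).
Proof. by apply: measurableX; exact: measurable_itv. Qed.

Let count_law (B : set (R * R)) : measurable B -> forall k,
  P [set w | points_in (node_count G) (position G) B w = k] =
  (let rate := rho * fine (nu B) in
   rate ^+ k / k`!%:R * expR (- rate))%R%:E.
Proof.
move=> mB k; have [[_ _ _ law _] _] := G_rcn.
rewrite nuE//= -law//; last first.
  by apply: measurableI => //; exact: measurable_unit_square.
by congr (P _); apply/seteqP; split => w /=; rewrite points_inE_nodes.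
Qed.

Let count_independent m (B : 'I_m -> set (R * R)) :
  (forall i, measurable (B i)) -> trivIset [set: 'I_m] B ->
  forall k : 'I_m -> nat,
    P [set w | forall i, points_in (node_count G) (position G) (B i) w = k i] =
    \prod_(i < m) P [set w | points_in (node_count G) (position G) (B i) w = k i].
Proof.
move=> mB tB k; have [[_ _ _ _ indep] _] := G_rcn.
have := indep m (fun i => B i `&` unit_square).
have -> : (fun w => forall i, points_in (node_count G) (position G) (B i) w = k i) =
    (fun w => forall i, nodes_in G (B i `&` unit_square) w = k i).
  by apply/funext => w; apply/propext; split => H i; rewrite -H points_inE_nodes.
move=> ->//.
- apply: eq_bigr => i _; congr (P _).
  by apply/seteqP; split => w /=; rewrite points_inE_nodes.
- by move=> i; apply: measurableI => //; exact: measurable_unit_square.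
- by move=> i j _ _ [x [[Bi _] [Bj _]]]; apply: tB => //; exists x.
Qed.

Let mN : measurable_fun [set: T] (node_count G).
Proof. by have [[]] := G_rcn. Qed.

Let mX i : measurable_fun [set: T] (position G i).
Proof. by have [[_ mX _ _ _] _] := G_rcn. Qed.

Let edges : independent_edges P f G.
Proof. by have [] := G_rcn. Qed.

Let law n (F : n.-tuple (R * R) -> \bar R) :
  measurable_fun [set: n.-tuple (R * R)] F -> (forall x, 0 <= F x) ->
  \sum_(s : 'S_n) \int[P]_(w in [set w | node_count G w = n])
    F (permuted_points (position G) s w) =
  (expR (- rho) * rho ^+ n)%R%:E * \int[tuple_power nu n]_x F x.
Proof.
move=> mF F0.
(* Vertical lines are null for [nu], so abscissae tell independent points apart almost surely. *)
by apply: (symmetrized_law (h := fst)) => //; exact: count_independent.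
Qed.

Let count1 : P [set w | node_count G w = 1%N] = (rho * expR (- rho))%R%:E.
Proof.
rewrite (prob_count (X := position G) count_law).
by rewrite expr1 (_ : 1`! = 1%N)// divr1.
Qed.

Let c01 := unlinked01 f01.

Let c_ge0 x y : (0 <= unlinked f x y)%R.
Proof. by have /andP[] := c01 x y. Qed.

Let c_le1 x y : (unlinked f x y <= 1)%R.
Proof. by have /andP[] := c01 x y. Qed.

Let measurable_unlinked : measurable_fun [set: (R * R) * (R * R)]
  (fun z => unlinked f z.1 z.2).
Proof. by apply: measurable_funB => //; exact: (measurable_connection mf). Qed.

Let measurable_unlinked2 : measurable_fun [set: (R * R) * (R * R) * (R * R)]
  (fun z => unlinked f z.1.1 z.2 * unlinked f z.1.2 z.2)%R.
Proof.
apply: measurable_funM; apply: measurable_funB => //;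
  apply: (measurable_connection mf) => //; exact: measurableT_comp.
Qed.

Let unit_integral (u : R * R -> R) : (forall z, 0 <= u z <= 1)%R ->
  measurable_fun [set: R * R] u ->
  \int[nu]_z (u z)%:E = (fine (\int[nu]_z (u z)%:E))%:E.
Proof.
move=> u01 mu; rewrite fineK// ge0_fin_numE; last first.
  by apply: integral_ge0 => z _; rewrite lee_fin; have /andP[] := u01 z.
apply: (@le_lt_trans _ _ (\int[nu]_z (cst 1 z))).
  apply: ge0_le_integral => //.
  - by move=> z _; rewrite lee_fin; have /andP[] := u01 z.
  - exact/measurable_EFinP.
  - by move=> z _; rewrite lee_fin; have /andP[] := u01 z.
rewrite integral_cst// mul1e.
by apply: (@eq_ind_r _ _ (fun u => u < +oo) (ltry 1)); exact: probability_setT.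
Qed.

Let avoid1E x : \int[nu]_y (unlinked f x y)%:E = (avoid1 x)%:E.
Proof.
apply: unit_integral => //.
exact: (measurable_fun_pair2 x measurable_unlinked).
Qed.

Let avoid2E x y : \int[nu]_z (unlinked f x z * unlinked f y z)%:E = (avoid2 x y)%:E.
Proof.
apply: unit_integral => [z|].
  by rewrite mulr_ge0// mulr_ile1.
exact: (measurable_fun_pair2 (x, y) measurable_unlinked2).
Qed.

Lemma avoid1_ge0 x : (0 <= avoid1 x)%R.
Proof. by apply: fine_ge0; apply: integral_ge0 => y _; rewrite lee_fin. Qed.

Lemma avoid2_ge0 x y : (0 <= avoid2 x y)%R.
Proof.
by apply: fine_ge0; apply: integral_ge0 => z _; rewrite lee_fin mulr_ge0.
Qed.

Lemma measurable_avoid1 : measurable_fun [set: R * R] avoid1.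
Proof.
apply: (measurableT_comp (f := fine) (g := fun x => \int[nu]_y (unlinked f x y)%:E)).
  exact: fine_measurable.
apply: (measurable_fun_fubini_tonelli_F (m2 := nu)
  (fun z : (R * R) * (R * R) => (unlinked f z.1 z.2)%:E)).
  exact/measurable_EFinP.
by move=> z; rewrite lee_fin.
Qed.

Lemma measurable_avoid2 :
  measurable_fun [set: (R * R) * (R * R)] (fun z => avoid2 z.1 z.2).
Proof.
apply: (measurableT_comp (f := fine)
  (g := fun z : (R * R) * (R * R) =>
    \int[nu]_y (unlinked f z.1 y * unlinked f z.2 y)%:E)).
  exact: fine_measurable.
apply: (measurable_fun_fubini_tonelli_F (m2 := nu)
  (fun z : (R * R) * (R * R) * (R * R) =>
    (unlinked f z.1.1 z.2 * unlinked f z.1.2 z.2)%:E)).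
  exact/measurable_EFinP.
by move=> z; rewrite lee_fin mulr_ge0.
Qed.

Let pmf n : R := (expR (- rho) * rho ^+ n / n`!%:R)%R.

Let S1 n := \sum_(i < n) P (isolated G A i).
Let S2 n := \sum_(i < n) \sum_(k < n | k != i) P (isolated G A i `&` isolated G A k).

Let div_fact n (a b : \bar R) : n`!%:R%:E * a = b -> a = (n`!%:R^-1)%R%:E * b.
Proof.
by move=> <-; rewrite muleA -EFinM mulVf ?mul1e.
Qed.

(** Singling out one of [n.+1] nodes leaves [n] others; once the factorial is divided out, their
    weight is again Poisson, up to the factor [rho]. *)
Let first_moment n :
  S1 n.+1 = \int[nu]_x (\1_A x * rho * pmf n * avoid1 x ^+ n)%:E.
Proof.
have m1A : measurable_fun [set: R * R] (\1_A : R * R -> R) by exact: measurable_indic.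
have := mecke1 law n m1A (fun=> ltac:(exact: ler0n)) measurable_unlinked c_ge0.
rewrite [X in _ * X = _](_ : _ = S1 n.+1); last first.
  by apply: eq_bigr => i _; rewrite (prob_isolated1 mN mX mf f01 edges).
move=> /div_fact ->.
have ma : measurable_fun [set: R * R] (fun x => \1_A x * avoid1 x ^+ n)%R.
  by apply: measurable_funM => //; apply: measurable_funX; exact: measurable_avoid1.
have a0 x : (0 <= \1_A x * avoid1 x ^+ n)%R.
  by rewrite mulr_ge0// exprn_ge0// avoid1_ge0.
rewrite muleA -EFinM.
under eq_integral do rewrite avoid1E -EFin_expe -EFinM.
rewrite -ge0_integralZl//.
- apply: eq_integral => x _; rewrite -EFinM; congr EFin.
  by rewrite /pmf exprS; ring.
- exact/measurable_EFinP.
- by move=> x _; rewrite lee_fin.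
- by rewrite lee_fin mulr_ge0// mulr_ge0 ?expR_ge0// exprn_ge0.
Qed.

Let measurable_integrand2 (a : (R * R) * (R * R) -> R) :
  measurable_fun [set: (R * R) * (R * R)] a -> (forall z, 0 <= a z)%R ->
  measurable_fun [set: R * R] (fun x => \int[nu]_y (a (x, y))%:E).
Proof.
move=> ma a0; apply: (measurable_fun_fubini_tonelli_F (m2 := nu) (EFin \o a)).
  exact/measurable_EFinP.
by move=> z; rewrite lee_fin.
Qed.

Let m1A2 : measurable_fun [set: (R * R) * (R * R)]
  (fun z => \1_A z.1 * \1_A z.2 : R)%R.
Proof. by apply: measurable_funM; apply: measurableT_comp. Qed.

Let integrand2 n (x y : R * R) : R :=
  (\1_A x * \1_A y * rho ^+ 2 * pmf n * avoid2 x y ^+ n)%R.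

Let integrand2_ge0 n x y : (0 <= integrand2 n x y)%R.
Proof.
by rewrite /integrand2 !mulr_ge0 ?exprn_ge0 ?avoid2_ge0.
Qed.

Let measurable_integrand2n n : measurable_fun [set: (R * R) * (R * R)]
  (fun z => integrand2 n z.1 z.2).
Proof.
apply: measurable_funM; last first.
  by apply: measurable_funX; exact: measurable_avoid2.
by do 2 apply: measurable_funM => //.
Qed.

Let second_moment n :
  S2 n.+2 <= \int[nu]_x \int[nu]_y (integrand2 n x y)%:E.
Proof.
have A2_ge0 x y : (0 <= \1_A x * \1_A y :> R)%R by rewrite mulr_ge0.
have c2_ge0 x y z : (0 <= unlinked f x z * unlinked f y z)%R by rewrite mulr_ge0.
have e : n`!%:R%:E * (\sum_(i < n.+2) \sum_(k < n.+2 | k != i)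
    \int[P]_(w in [set w | node_count G w = n.+2])
     (\1_A (position G i w) * \1_A (position G k w) *
      \prod_(j < n.+2 | (j != i) && (j != k))
      (unlinked f (position G i w) (position G j w) *
       unlinked f (position G k w) (position G j w)))%:E) =
    (expR (- rho) * rho ^+ n.+2)%:E * \int[nu]_x \int[nu]_y
      ((\1_A x * \1_A y)%:E *
       (\int[nu]_z (unlinked f x z * unlinked f y z)%:E) ^+ n).
  exact: (mecke2 law n m1A2 A2_ge0 measurable_unlinked2 c2_ge0).
apply: (@le_trans _ _ (n`!%:R^-1%:E * ((expR (- rho) * rho ^+ n.+2)%:E *
    \int[nu]_x \int[nu]_y ((\1_A x * \1_A y)%:E *
       (\int[nu]_z (unlinked f x z * unlinked f y z)%:E) ^+ n)))).
  rewrite -(div_fact e); apply: lee_sum => i _; apply: lee_sum => k ki.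
  exact: (prob_isolated2 mN mX mf f01 edges mA ki).
under eq_integral => x _.
  under eq_integral => y _ do rewrite avoid2E -EFin_expe -EFinM.
  over.
pose a (z : (R * R) * (R * R)) := (\1_A z.1 * \1_A z.2 * avoid2 z.1 z.2 ^+ n)%R.
have ma : measurable_fun [set: (R * R) * (R * R)] a.
  by apply: measurable_funM => //; apply: measurable_funX; exact: measurable_avoid2.
have a0 z : (0 <= a z)%R by rewrite !mulr_ge0 ?exprn_ge0 ?avoid2_ge0.
have k0 : (0 <= n`!%:R^-1 * (expR (- rho) * rho ^+ n.+2))%R.
  by rewrite mulr_ge0 ?invr_ge0 ?ler0n// mulr_ge0 ?expR_ge0 ?exprn_ge0.
rewrite muleA -EFinM -(@ge0_integralZl _ _ _ nu setT measurableT
  (fun x => \int[nu]_y (a (x, y))%:E)); first last.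
- by rewrite lee_fin.
- by move=> x _; apply: integral_ge0 => y _; rewrite lee_fin.
- exact: measurable_integrand2.
rewrite le_eqVlt; apply/orP; left; apply/eqP; apply: eq_integral => x _.
rewrite -(@ge0_integralZl _ _ _ nu setT measurableT (fun y => (a (x, y))%:E)); first last.
- by rewrite lee_fin.
- by move=> y _; rewrite lee_fin.
- by apply/measurable_EFinP; exact: (measurable_fun_pair2 x ma).
apply: eq_integral => y _; rewrite -EFinM; congr EFin.
by rewrite /integrand2 /a /pmf !exprS /=; ring.
Qed.

Lemma measurable_generating (a q : R * R -> R) (u : R) :
  measurable_fun [set: R * R] a -> measurable_fun [set: R * R] q ->
  measurable_fun [set: R * R] (fun x => a x * expR (- (u * (1 - q x))))%R.
Proof.
move=> ma mq; apply: measurable_funM => //.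
apply: (measurableT_comp (f := expR) (g := fun x => - (u * (1 - q x)))%R).
  exact: measurable_expR.
by apply: measurableT_comp => //; apply: measurable_funM => //; exact: measurable_funB.
Qed.

Let sum_first_moment :
  \sum_(n <oo) S1 n.+1 =
  \int[nu]_x (\1_A x * rho * expR (- (rho * (1 - avoid1 x))))%:E.
Proof.
rewrite (eq_eseriesr (fun n _ => first_moment n)) -integral_nneseries//.
- apply: eq_integral => x _; rewrite poisson_generating ?avoid1_ge0//.
  by rewrite mulr_ge0.
- move=> n; apply/measurable_EFinP; apply: measurable_funM.
    by do 2 apply: measurable_funM => //.
  by apply: measurable_funX; exact: measurable_avoid1.
- by move=> n x _; rewrite lee_fin !mulr_ge0 ?exprn_ge0 ?avoid1_ge0.
Qed.

Let sum_second_moment :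
  \sum_(n <oo) S2 n.+2 <=
  \int[nu]_x \int[nu]_y
    (\1_A x * \1_A y * rho ^+ 2 * expR (- (rho * (1 - avoid2 x y))))%:E.
Proof.
apply: (le_trans (lee_nneseries _ (fun n _ => second_moment n))).
  move=> n _ _; apply: sume_ge0 => i _; apply: sume_ge0 => k _; exact: measure_ge0.
rewrite -(@integral_nneseries _ _ _ nu _ measurableT
  (fun n x => \int[nu]_y (integrand2 n x y)%:E)); last 2 first.
- by move=> n; exact: (measurable_integrand2 (a := fun z => integrand2 n z.1 z.2)).
- by move=> n x _; apply: integral_ge0 => y _; rewrite lee_fin.
rewrite le_eqVlt; apply/orP; left; apply/eqP; apply: eq_integral => x _.
rewrite -(@integral_nneseries _ _ _ nu _ measurableT
  (fun n y => (integrand2 n x y)%:E)); last 2 first.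
- move=> n; apply/measurable_EFinP.
  exact: (measurable_fun_pair2 x (measurable_integrand2n n)).
- by move=> n y _; rewrite lee_fin.
apply: eq_integral => y _; rewrite poisson_generating ?avoid2_ge0//.
by rewrite !mulr_ge0// exprn_ge0.
Qed.

Let S2_ge0 n : 0 <= S2 n.
Proof. by do 2 (apply: sume_ge0 => ? _); exact: measure_ge0. Qed.

Let S1_ge0 n : 0 <= S1 n.
Proof. by apply: sume_ge0 => ? _; exact: measure_ge0. Qed.

Let mC : measurable [set w | is_connected G w].
Proof. exact: measurable_connected mN edges. Qed.

(** From two nodes on, an isolated node disconnects the network. The term of a single node is
    charged to the probability that there is exactly one node. *)
Let sum_some_isolated :
  \sum_(n <oo) P [set w | exists i : 'I_n.+1, isolated G A i w] <=
  P (~` [set w | is_connected G w]) + (rho * expR (- rho))%:E.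
Proof.
have mI n : measurable [set w | exists i : 'I_n.+1, isolated G A i w].
  apply: measurable_exists_fin => i.
  exact: (measurable_isolated mN mX edges mA).
have m1 : measurable [set w | node_count G w = 1%N] by exact: measurable_count.
rewrite -(@measure_semi_bigcup _ _ _ P
  (fun n => [set w | exists i : 'I_n.+1, isolated G A i w])) //; last 2 first.
- by move=> n k _ _ [w [[i [Nw _ _]] [j [Nw' _ _]]]]; case: (etrans (esym Nw) Nw').
- exact: bigcupT_measurable.
rewrite -count1; apply: (@le_trans _ _ (P (~` [set w | is_connected G w] `|`
  [set w | node_count G w = 1%N]))).
  apply: le_measure.
  - by apply: mem_set; exact: bigcupT_measurable.
  - by apply: mem_set; apply: measurableU => //; exact: measurableC.
  - move=> w [[|n] _ [i iso]]; first by right; case: iso.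
    by left; exact: isolated_not_connected iso.
by apply: measureU2 => //; exact: measurableC.
Qed.

Lemma isolated_moment_bound :
  (t * (2 - t))%:E *
    \int[nu]_x (\1_A x * rho * expR (- (rho * (1 - avoid1 x))))%:E <=
  P (~` [set w | is_connected G w]) + (rho * expR (- rho))%:E +
  (t ^+ 2)%:E * \int[nu]_x \int[nu]_y
    (\1_A x * \1_A y * rho ^+ 2 * expR (- (rho * (1 - avoid2 x y))))%:E.
Proof.
have tt0 : (0 <= t * (2 - t))%R.
  by case/andP: t02 => t0 t2; rewrite mulr_ge0// subr_ge0.
(* A single node forms no pair, so the series of pairs effectively starts at two nodes. *)
have S21 : \sum_(n <oo) S2 n.+1 = \sum_(n <oo) S2 n.+2.
  rewrite nneseries_recl// [X in X + _](_ : _ = 0) ?add0e; last first.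
    by rewrite /S2 big_ord1 big1// => k; rewrite !ord1 eqxx.
  by rewrite -(@nneseries_addn _ (fun n => S2 n.+1))//; apply: eq_eseriesr => n _; rewrite addn1.
rewrite -sum_first_moment -nneseriesZl//.
apply: (le_trans (lee_nneseries _ (fun n _ => second_moment_events P
  (fun i : 'I_n.+1 => measurable_isolated mN mX edges mA i) t02))).
  by move=> n _ _; apply: mule_ge0; [rewrite lee_fin|exact: S1_ge0].
rewrite nneseriesD; last 2 first.
- by move=> n _ _; exact: measure_ge0.
- by move=> n _ _; apply: mule_ge0; [rewrite lee_fin sqr_ge0|exact: S2_ge0].
apply: leeD; first exact: sum_some_isolated.
rewrite nneseriesZl => [|n _]; last exact: S2_ge0.
apply: lee_wpmul2l; first by rewrite lee_fin sqr_ge0.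
by apply: (le_trans _ sum_second_moment); rewrite -S21.
Qed.

End moment_bound.

(** * Euclidean distance, squares and disks *)

Section euclidean_plane.
Context {R : realType}.
Implicit Types x y z : R * R.

Lemma euclid_norm_ge0 z : 0 <= euclid_norm z.
Proof. exact: sqrtr_ge0. Qed.

Lemma euclid_norm_sqr z : euclid_norm z ^+ 2 = z.1 ^+ 2 + z.2 ^+ 2.
Proof. by rewrite sqr_sqrtr// addr_ge0// sqr_ge0. Qed.

Lemma euclid_norm_le z (a : R) : 0 <= a ->
  (euclid_norm z <= a) = (z.1 ^+ 2 + z.2 ^+ 2 <= a ^+ 2).
Proof.
by move=> a0; rewrite -euclid_norm_sqr ler_sqr// nnegrE euclid_norm_ge0.
Qed.

Lemma euclid_norm_lt z (a : R) : 0 <= a ->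
  (euclid_norm z < a) = (z.1 ^+ 2 + z.2 ^+ 2 < a ^+ 2).
Proof.
by move=> a0; rewrite -euclid_norm_sqr ltr_sqr// nnegrE euclid_norm_ge0.
Qed.

Lemma euclid_normD x y : euclid_norm (x + y) <= euclid_norm x + euclid_norm y.
Proof.
rewrite euclid_norm_le ?addr_ge0 ?euclid_norm_ge0//=.
rewrite [leRHS]sqrrD !euclid_norm_sqr.
suff : x.1 * y.1 + x.2 * y.2 <= euclid_norm x * euclid_norm y by nra.
apply: le_trans (ler_norm _) _.
rewrite -ler_sqr ?nnegrE ?mulr_ge0 ?euclid_norm_ge0// real_normK ?num_real//.
rewrite exprMn !euclid_norm_sqr.
(* Lagrange's identity: this square is the defect in the Cauchy-Schwarz inequality. *)
have := sqr_ge0 (x.1 * y.2 - x.2 * y.1); nra.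
Qed.

Lemma euclid_distC x y : euclid_norm (x - y) = euclid_norm (y - x).
Proof. by rewrite -opprB euclid_normN. Qed.

Lemma euclid_dist_triangle x y z :
  euclid_norm (x - z) <= euclid_norm (x - y) + euclid_norm (y - z).
Proof.
have -> : x - z = (x - y) + (y - z) by rewrite addrA subrK.
exact: euclid_normD.
Qed.

Lemma euclid_norm_scale (a : R) z : 0 <= a ->
  euclid_norm (a * z.1, a * z.2) = a * euclid_norm z.
Proof.
move=> a0; rewrite /euclid_norm/= !exprMn -mulrDr sqrtrM ?sqr_ge0//.
by rewrite sqrtr_sqr ger0_norm.
Qed.

Lemma abs_fst_le_euclid_norm z : `|z.1| <= euclid_norm z.
Proof. by rewrite -sqrtr_sqr ler_sqrt ?addr_ge0 ?sqr_ge0// lerDl sqr_ge0. Qed.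

Lemma abs_snd_le_euclid_norm z : `|z.2| <= euclid_norm z.
Proof. by rewrite -sqrtr_sqr ler_sqrt ?addr_ge0 ?sqr_ge0// lerDr sqr_ge0. Qed.

(** Squares stand in for disks when areas are computed: a product of intervals has an explicit
    measure, and only constants are lost. *)
Definition cell (c : R * R) (a : R) : set (R * R) :=
  `[c.1 - a, c.1 + a]%classic `*` `[c.2 - a, c.2 + a]%classic.

Lemma cellP c a z : cell c a z <-> `|z.1 - c.1| <= a /\ `|z.2 - c.2| <= a.
Proof.
rewrite /cell /= !in_itv /= !ler_norml.
by split=> -[/andP[? ?] /andP[? ?]]; split; apply/andP; split; lra.
Qed.

Lemma measurable_cell c a : measurable (cell c a).
Proof. by apply: measurableX; exact: measurable_itv. Qed.

Lemma plane_measure_cell c a : 0 <= a ->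
  plane_measure (cell c a) = (4 * a ^+ 2)%:E.
Proof.
move=> a0; transitivity (lebesgue_measure `[(c.1 - a)%R, (c.1 + a)%R]%classic *
    lebesgue_measure `[(c.2 - a)%R, (c.2 + a)%R]%classic)%E.
  by apply: product_measure1E; exact: measurable_itv.
rewrite !lebesgue_measure_itv/= !lte_fin.
have [->|an0] := eqVneq a 0.
  by rewrite !addr0 !subr0 !ltxx mule0 expr0n/= mulr0.
have {}a0 : 0 < a by rewrite lt_def an0.
rewrite !ifT; [|lra|lra].
by rewrite -!EFinB -EFinM; congr EFin; ring.
Qed.

Lemma cell_subset_ball c a (m : R) z : 0 < m -> a = m / 2 -> cell c a z ->
  euclid_norm (z - c) < m.
Proof.
move=> m0 -> /cellP[z1 z2]; rewrite euclid_norm_lt ?(ltW m0)//=.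
have h1 : (z.1 - c.1) ^+ 2 <= (m / 2) ^+ 2.
  by rewrite -real_normK ?num_real// lerXn2r// nnegrE//; lra.
have h2 : (z.2 - c.2) ^+ 2 <= (m / 2) ^+ 2.
  by rewrite -real_normK ?num_real// lerXn2r// nnegrE//; lra.
nra.
Qed.

End euclidean_plane.

(** * Changes of variables and Gaussian integrals in the plane *)

Section plane_integrals.
Context {R : realType}.
Notation mR := (measurableTypeR R).
Notation lambda := (@lebesgue_measure R).

Let reflect_scale (a r : R) (y : mR) : mR := (a - y) / r.

Let measurable_reflect_scale a r : measurable_fun [set: mR] (reflect_scale a r).
Proof.
apply: measurable_funM => //.
by apply: measurable_funB => //; exact: measurable_id.
Qed.

(** The image of Lebesgue measure under the reflected dilation, divided by [r], gives every interval
    its length, hence is Lebesgue measure. *)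
Lemma integral_affine (a r : R) (h : mR -> \bar R) : 0 < r ->
  measurable_fun [set: mR] h -> (forall y, 0 <= h y)%E ->
  (\int[lambda]_y h ((a - y) / r)%R = r%:E * \int[lambda]_y h y)%E.
Proof.
move=> r0 mh h0.
pose mu : {measure set mR -> \bar R} :=
  mscale (NngNum (ltW (etrans (invr_gt0 r) r0)))
    (measure_function_pushforward__canonical__measure_function_Measure
       lambda (measurable_reflect_scale a r)).
have muE : forall X, measurable X -> lambda X = mu X.
  apply: lebesgue_measure_unique => _ [[p q] _ <-] /=.
  rewrite /mu /= /mscale /= /pushforward.
  rewrite (_ : _ @^-1` _ = `[(a - q * r)%R, (a - p * r)%R[%classic); last first.
    apply/seteqP; split => y /=; rewrite /reflect_scale !in_itv/= ltr_pdivlMr// ler_pdivrMr//;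
      by move=> /andP[? ?]; apply/andP; split; lra.
  rewrite !lebesgue_measure_itv/= !lte_fin.
  have -> : (a - q * r < a - p * r) = (p < q) by rewrite ltrD2l ltrN2 ltr_pM2r.
  case: ifP => _; last by rewrite mule0.
  rewrite -!EFinB -EFinM; congr EFin.
  by field; rewrite gt_eqF.
have -> : (\int[lambda]_y h y = \int[mu]_y h y)%E.
  by apply: eq_measure_integral => X mX _; exact: muE.
rewrite /mu ge0_integral_mscale//= (ge0_integral_pushforward (measurable_reflect_scale a r))//.
by rewrite muleA -EFinM divff ?gt_eqF// mul1e preimage_setT.
Qed.

Lemma plane_fubini (h : mR * mR -> \bar R) :
  measurable_fun [set: mR * mR] h -> (forall z, 0 <= h z)%E ->
  (\int[plane_measure]_z h z = \int[lambda]_x \int[lambda]_y h (x, y))%E.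
Proof. by move=> mh h0; rewrite fubini_tonelli1. Qed.

Lemma plane_integral_affine (x : R * R) (r : R) (h : mR * mR -> \bar R) : 0 < r ->
  measurable_fun [set: mR * mR] h -> (forall z, 0 <= h z)%E ->
  (\int[plane_measure]_z h (((x.1 - z.1) / r)%R, ((x.2 - z.2) / r)%R) =
   (r ^+ 2)%:E * \int[plane_measure]_z h z)%E.
Proof.
move=> r0 mh h0.
rewrite plane_fubini//; last first.
  apply: measurableT_comp => //; apply/measurable_fun_pairP; split.
    exact: (measurableT_comp (measurable_reflect_scale x.1 r) measurable_fst).
  exact: (measurableT_comp (measurable_reflect_scale x.2 r) measurable_snd).
rewrite plane_fubini//.
have mhx u : measurable_fun [set: mR] (fun v => h (u, v)).
  exact: (measurable_fun_pair2 u mh).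
have mH : measurable_fun [set: mR] (fun u => \int[lambda]_v h (u, v))%E.
  exact: (measurable_fun_fubini_tonelli_F (m2 := lambda) h).
have H0 u : (0 <= \int[lambda]_v h (u, v))%E by exact: integral_ge0.
transitivity (\int[lambda]_u (r%:E * \int[lambda]_v h (((x.1 - u) / r)%R, v)))%E.
  by apply: eq_integral => u _; rewrite -(integral_affine x.2 r0 (mhx _)).
rewrite ge0_integralZl ?lee_fin ?(ltW r0)//; last first.
  exact: (measurableT_comp mH (measurable_reflect_scale x.1 r)).
rewrite (integral_affine x.1 (h := fun u => (\int[lambda]_v h (u, v))%E))//.
by rewrite muleA -EFinM.
Qed.

Lemma measurable_euclid_norm : measurable_fun [set: mR * mR] (@euclid_norm R).
Proof.
apply: (measurableT_comp (f := Num.sqrt : mR -> mR)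
  (g := fun z : mR * mR => z.1 ^+ 2 + z.2 ^+ 2)).
  by apply: nondecreasing_measurable => // s t; exact: ler_wsqrtr.
by apply: measurable_funD; apply: measurable_funX.
Qed.

Lemma integral_radial (x : R * R) (r : R) (k : R -> R) : 0 < r ->
  measurable_fun [set: mR * mR] (fun z => k (euclid_norm z)) ->
  (forall t, 0 <= t -> 0 <= k t) ->
  (\int[plane_measure]_z (k (euclid_norm (x - z) / r))%:E =
   (r ^+ 2)%:E * \int[plane_measure]_z (k (euclid_norm z))%:E)%E.
Proof.
move=> r0 mk k0; rewrite -(plane_integral_affine x r0)//.
- apply: eq_integral => z _; congr (k _)%:E.
  rewrite -[RHS]/(euclid_norm (((x - z).1) / r, ((x - z).2) / r)).
  by rewrite ![_ / r]mulrC euclid_norm_scale// invr_ge0 ltW.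
- exact/measurable_EFinP.
- by move=> z; rewrite lee_fin k0// euclid_norm_ge0.
Qed.

Lemma integral_plane_gauss :
  (\int[plane_measure]_z (expR (- (@euclid_norm R z ^+ 2)))%:E = (@pi R)%:E)%E.
Proof.
have mg : measurable_fun [set: mR * mR] (fun z => expR (- (@euclid_norm R z ^+ 2))).
  apply: measurableT_comp => //; apply: measurableT_comp => //.
  by apply: measurable_funX; exact: measurable_euclid_norm.
rewrite plane_fubini; first last.
- by move=> z; rewrite lee_fin expR_ge0.
- exact/measurable_EFinP.
have mG : measurable_fun [set: mR] (fun y : mR => (gauss_fun y)%:E).
  by apply/measurable_EFinP; exact: measurable_gauss_fun.
have G0 y : (0 <= (@gauss_fun R y)%:E)%E by rewrite lee_fin gauss_fun_ge0.
transitivity (\int[lambda]_x ((gauss_fun x)%:E * (Num.sqrt pi)%:E))%E.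
  apply: eq_integral => x _; rewrite -integralT_gauss -ge0_integralZl//.
  apply: eq_integral => y _; rewrite -EFinM euclid_norm_sqr/= opprD expRD.
  by rewrite /gauss_fun.
rewrite ge0_integralZr ?lee_fin ?sqrtr_ge0// integralT_gauss -EFinM -expr2.
by rewrite sqr_sqrtr// pi_ge0.
Qed.

Lemma integral_gauss_dist (x : R * R) (c : R) : 0 < c ->
  (\int[plane_measure]_z (expR (- (c * euclid_norm (x - z) ^+ 2)))%:E =
   (pi / c)%:E)%E.
Proof.
move=> c0; pose r := (Num.sqrt c)^-1.
have r0 : 0 < r by rewrite invr_gt0 sqrtr_gt0.
transitivity (\int[plane_measure]_z
    ((fun t => expR (- t ^+ 2)) (euclid_norm (x - z) / r))%:E)%E.
  apply: eq_integral => z _; congr (expR (- _))%:E.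
  by rewrite /r invrK exprMn (sqr_sqrtr (ltW c0)) mulrC.
rewrite (integral_radial x r0 (k := fun t => expR (- t ^+ 2))).
- rewrite integral_plane_gauss -EFinM; congr EFin.
  by rewrite /r exprVn sqr_sqrtr ?(ltW c0)// mulrC.
- apply: measurableT_comp => //; apply: measurableT_comp => //.
  by apply: measurable_funX; exact: measurable_euclid_norm.
- by move=> t _; exact: expR_ge0.
Qed.

End plane_integrals.

(** * The uniform law on the unit square *)

Section uniform_square.
Context {R : realType}.
Notation mR := (measurableTypeR R).

Lemma plane_measure_unit_square : plane_measure (@unit_square R) = 1%E.
Proof.
pose I : set R := `[- 2^-1, 2^-1[%classic.
transitivity (lebesgue_measure I * lebesgue_measure I)%E.
  by apply: product_measure1E; exact: measurable_itv.
rewrite /I lebesgue_measure_itv/= lte_fin ifT; last lra.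
by rewrite -EFinB -EFinM; congr EFin; field.
Qed.

Definition square_restriction : set (mR * mR) -> \bar R :=
  mrestr plane_measure (@measurable_unit_square R).

HB.instance Definition _ := Measure.on square_restriction.

Let square_restriction_setT : square_restriction setT = 1%E.
Proof.
by rewrite /square_restriction /mrestr setTI plane_measure_unit_square.
Qed.

HB.instance Definition _ :=
  Measure_isProbability.Build _ _ _ square_restriction square_restriction_setT.

(* The identity, from the display carried by [measurableTypeR R] to the default
   display, in which the nodes of a network live. *)
Definition to_plane (z : mR * mR) : R * R := z.

Lemma measurable_to_plane : measurable_fun [set: mR * mR] to_plane.
Proof. by move=> _ B mB; rewrite setTI. Qed.

HB.instance Definition _ :=
  isMeasurableFun.Build _ _ _ _ to_plane measurable_to_plane.

Definition uniform_square : probability (R * R)%type R :=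
  distribution square_restriction to_plane.

Lemma uniform_squareE (B : set (R * R)) : measurable B ->
  uniform_square B = plane_measure (B `&` unit_square).
Proof. by []. Qed.

Lemma uniform_square_line (a : R) : uniform_square (fst @^-1` [set a]) = 0%E.
Proof.
apply/eqP; rewrite -measure_le0.
have line0 : plane_measure ([set a] `*` [set: R]) = 0%E.
  transitivity (lebesgue_measure [set a] * lebesgue_measure [set: R])%E.
    by apply: product_measure1E => //; exact: measurable_set1.
  by rewrite lebesgue_measure_set1 mul0e.
have m_line : measurable (fst @^-1` [set a] : set (mR * mR)).
  rewrite -[X in measurable X]setTI.
  by apply: measurable_fst => //; exact: measurable_set1.
apply: (@le_trans _ _ (plane_measure ([set a] `*` [set: R]))); last by rewrite line0.
apply: (@le_measure _ _ _ plane_measure).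
- by apply: mem_set; apply: measurableI => //; exact: measurable_unit_square.
- by apply: mem_set; apply: measurableX => //; exact: measurable_set1.
- by move=> z [/= za _].
Qed.

Lemma integral_uniform_square (h : R * R -> \bar R) :
  measurable_fun [set: R * R] h -> (forall z, 0 <= h z)%E ->
  (\int[uniform_square]_z h z = \int[plane_measure]_(z in unit_square) h z)%E.
Proof.
move=> mh h0; transitivity (\int[square_restriction]_z (h \o to_plane) z)%E.
  exact: (@ge0_integral_distribution _ _ _ _ _ square_restriction to_plane h mh h0).
exact: (ge0_integral_mrestr plane_measure (@measurable_unit_square R)
  (f := h : mR * mR -> \bar R) mh h0).
Qed.

Lemma integral_uniform_square_le (h : R * R -> \bar R) :
  measurable_fun [set: R * R] h -> (forall z, 0 <= h z)%E ->
  (\int[uniform_square]_z h z <= \int[plane_measure]_z h z)%E.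
Proof.
move=> mh h0; rewrite integral_uniform_square//.
apply: ge0_subset_integral => //; exact: measurable_unit_square.
Qed.

Lemma uniform_square_cell (c : R * R) (a : R) : 0 <= a ->
  cell c a `<=` unit_square -> uniform_square (cell c a) = (4 * a ^+ 2)%:E.
Proof.
move=> a0 cS; rewrite -(plane_measure_cell c a0) uniform_squareE; last exact: measurable_cell.
by rewrite setIidl.
Qed.

End uniform_square.

(** * Tail and threshold of the connection function *)

Section connection_function.
Context {R : realType}.
Notation mR := (measurableTypeR R).
Variables (g : R -> R) (C : R).
Hypothesis g_range : forall x : R, 0 <= x -> 0 <= g x <= 1.
Hypothesis g_nonincreasing : forall x y : R, 0 <= x -> x <= y -> g y <= g x.
Hypothesis C_def : (\int[plane_measure]_z (g (euclid_norm z))%:E)%E = C%:E.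
Hypothesis C_gt0 : 0 < C.

Let g_ge0 x : 0 <= x -> 0 <= g x. Proof. by move=> /g_range /andP[]. Qed.
Let g_le1 x : 0 <= x -> g x <= 1. Proof. by move=> /g_range /andP[]. Qed.

Lemma measurable_radial (r : R) : 0 <= r ->
  measurable_fun [set: mR * mR] (fun z => g (euclid_norm z / r)).
Proof.
move=> r0.
(* Monotonicity is known on the nonnegative half-line only; truncating the argument at 0 yields a
   function monotone on the whole line, with the same values at distances. *)
have mg : measurable_fun [set: mR] (fun t : mR => g (Num.max t 0) : mR).
  apply: nonincreasing_measurable => // s t st; apply: g_nonincreasing.
    by rewrite le_max lexx orbT.
  by rewrite ge_max !le_max st lexx orbT.
rewrite (_ : (fun z => _) = (fun t => g (Num.max t 0)) \o
    (fun z : mR * mR => euclid_norm z / r : mR)).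
  apply: measurableT_comp => //.
  by apply: measurable_funM => //; exact: measurable_euclid_norm.
apply/funext => z /=; congr g; apply/esym/max_idPl.
by rewrite divr_ge0// euclid_norm_ge0.
Qed.

Lemma measurable_radial1 :
  measurable_fun [set: mR * mR] (fun z => g (euclid_norm z)).
Proof.
rewrite (_ : (fun z => _) = (fun z => g (euclid_norm z / 1))).
  exact: measurable_radial.
by apply/funext => z; rewrite divr1.
Qed.

(** By monotonicity [g] is at least [g x] on the square of side [x] centred at the origin, which
    lies in the disk of radius [x] and has area [x ^+ 2]. *)
Lemma connection_function_tail (x : R) : 0 < x -> g x <= C / x ^+ 2.
Proof.
move=> x0; rewrite ler_pdivlMr ?exprn_gt0//.
rewrite -lee_fin -C_def.
have x2 : 0 <= x / 2 by rewrite divr_ge0// ltW.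
pose B : set (R * R) := cell (0, 0) (x / 2).
have mB : measurable B by exact: measurable_cell.
have -> : ((g x * x ^+ 2)%:E =
    \int[plane_measure]_(z in B) (cst (g x)%:E z))%E.
  rewrite integral_cst; last exact: mB.
  transitivity ((g x)%:E * (4 * (x / 2) ^+ 2)%:E)%E.
    by rewrite -EFinM; congr EFin; field.
  by congr (_ * _)%E; apply/esym/plane_measure_cell.
apply: (@le_trans _ _
    (\int[plane_measure]_(z in B) (g (euclid_norm z))%:E)%E).
  apply: ge0_le_integral => //.
  - by move=> z _; rewrite lee_fin g_ge0// ltW.
  - by apply/measurable_EFinP; apply: measurable_funTS; exact: measurable_radial1.
  move=> z cz; rewrite lee_fin; apply: g_nonincreasing; first exact: euclid_norm_ge0.
  by have := cell_subset_ball x0 erefl cz; rewrite subr0 => /ltW.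
apply: ge0_subset_integral => //.
- by apply/measurable_EFinP; exact: measurable_radial1.
- by move=> z _; rewrite lee_fin g_ge0// euclid_norm_ge0.
Qed.

Lemma connection_function_pos : exists2 t, 0 < t & 0 < g t.
Proof.
apply: contrapT => ng.
have g0 t : 0 < t -> g t = 0.
  move=> t0; apply/eqP; rewrite eq_le (g_ge0 (ltW t0)) andbT leNgt.
  by apply/negP => gt; apply: ng; exists t.
(* The square of half-side [e] has area [4 * e ^+ 2 <= C / 2], too little for a function at most one
   that vanishes off the origin to have integral [C]. *)
pose e := Num.min 1 (C / 8).
have e0 : 0 < e by rewrite lt_min ltr01 divr_gt0.
have : (C%:E <= (4 * e ^+ 2)%:E)%E.
  rewrite -C_def -(plane_measure_cell (0, 0) (ltW e0)).
  have mc := measurable_cell (0, 0) e.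
  rewrite -[leRHS]mul1e -(integral_cst plane_measure mc).
  rewrite [leRHS]integral_mkcond; apply: ge0_le_integral => //.
  - by move=> z _; rewrite lee_fin g_ge0// euclid_norm_ge0.
  - by apply/measurable_EFinP; exact: measurable_radial1.
  - by apply/(measurable_restrict _ mc) => //.
  move=> z _; rewrite /patch; case: ifPn => [_|].
    by rewrite lee_fin g_le1// euclid_norm_ge0.
  rewrite notin_setE => ncz; rewrite g0// lt_neqAle euclid_norm_ge0 andbT.
  apply/eqP => nz; apply: ncz; apply/cellP; rewrite !subr0 /=.
  by split; [have := abs_fst_le_euclid_norm z|have := abs_snd_le_euclid_norm z];
    rewrite -nz => /le_trans; apply; exact: ltW.
rewrite lee_fin; have : e <= 1 by rewrite ge_min lexx.
have : e <= C / 8 by rewrite ge_min lexx orbT.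
nra.
Qed.

(** [tau] is half of a positive value of [g], hence at most [2^-1], and [l] is the supremum of the
    radii where [g] is at least [tau], finite by the tail bound. A supremum copes with jumps of [g],
    where no radius attains an intermediate value. *)
Lemma connection_threshold : exists tau l : R,
  [/\ 0 < tau <= 2^-1, 0 < l, forall t, 0 <= t < l -> tau <= g t &
    forall t, l < t -> g t <= 2^-1].
Proof.
have [t0 t0_gt0 gt0] := connection_function_pos.
pose tau := g t0 / 2.
have tau0 : 0 < tau by rewrite divr_gt0.
have tau_le : tau <= 2^-1 by have := g_le1 (ltW t0_gt0); rewrite /tau; lra.
pose S := [set t | 0 <= t /\ tau <= g t].
have S_t0 : S t0 by split; [exact: ltW|rewrite /tau; lra].
have S_sup : has_sup S.
  split; first by exists t0.
  exists (1 + C / tau) => t [t_ge0 gt].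
  have [t1|t1] := leP t 1; first by rewrite (le_trans t1)// lerDl divr_ge0// ltW.
  have tpos : 0 < t by rewrite (lt_trans ltr01).
  have := le_trans gt (connection_function_tail tpos).
  rewrite ler_pdivlMr ?exprn_gt0// => h.
  have : t <= C / tau.
    rewrite ler_pdivlMr// (le_trans _ h)// mulrC ler_wpM2l ?(ltW tau0)//.
    by rewrite expr2 ler_peMl// ltW.
  by move=> /le_trans; apply; rewrite lerDr.
exists tau, (sup S); split.
- by rewrite tau0.
- by apply: (lt_le_trans t0_gt0); apply: ub_le_sup => //; case: S_sup.
- move=> t /andP[t_ge0 tS].
  have [u [u0 gu]] := sup_adherent (etrans (subr_gt0 _ _) tS) S_sup.
  by rewrite subKr => tu; rewrite (le_trans gu)// g_nonincreasing// ltW.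
- move=> t St; rewrite (le_trans _ tau_le)// leNgt; apply/negP => gt.
  move: (St); rewrite ltNge => /negP; apply; apply: ub_le_sup; first by case: S_sup.
  split; last exact: ltW.
  rewrite (le_trans _ (ltW St))// (le_trans (ltW t0_gt0))//.
  by apply: ub_le_sup => //; case: S_sup.
Qed.

End connection_function.

Lemma ge0_integralZl_real d (E : measurableType d) (R : realType)
    (mu : {measure set E -> \bar R}) (c : R) (u : E -> R) :
  0 <= c -> measurable_fun [set: E] u -> (forall z, 0 <= u z) ->
  (\int[mu]_z (c * u z)%:E = c%:E * \int[mu]_z (u z)%:E)%E.
Proof.
move=> c0 mu0 u0; rewrite -ge0_integralZl_EFin//.
- by move=> z _; rewrite lee_fin.
- exact/measurable_EFinP.
Qed.

(** * Real-valued means of functions with values in the unit interval *)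

Section mean.
Context {d : measure_display} {E : measurableType d} {R : realType}.
Variable nu : probability E R.
Implicit Types u v : E -> R.

Definition mean u : R := fine (\int[nu]_z (u z)%:E).

(** Values between 0 and 1 make every integral finite, so that identities between means can be
    written and subtracted in [R]. *)
Definition unit_valued u :=
  measurable_fun [set: E] u /\ forall z, 0 <= u z <= 1.

Lemma meanE u : unit_valued u -> (\int[nu]_z (u z)%:E)%E = (mean u)%:E.
Proof.
move=> [mu u01]; rewrite /mean fineK// ge0_fin_numE; last first.
  by apply: integral_ge0 => z _; rewrite lee_fin; have /andP[] := u01 z.
apply: (@le_lt_trans _ _ (\int[nu]_z (cst 1%E z))%E).
  apply: ge0_le_integral => //.
  - by move=> z _; rewrite lee_fin; have /andP[] := u01 z.
  - exact/measurable_EFinP.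
  - by move=> z _; rewrite lee_fin; have /andP[] := u01 z.
rewrite integral_cst// mul1e.
by apply: (@le_lt_trans _ _ 1%E); [exact: probability_le1|exact: ltry].
Qed.

Lemma mean_ge0 u : unit_valued u -> 0 <= mean u.
Proof.
move=> u01; rewrite -lee_fin -meanE//; apply: integral_ge0 => z _.
by rewrite lee_fin; have /andP[] := u01.2 z.
Qed.

Lemma meanD u v : unit_valued u -> unit_valued v ->
  unit_valued (fun z => u z + v z) ->
  mean (fun z => u z + v z) = mean u + mean v.
Proof.
move=> hu hv huv; apply: EFin_inj; rewrite EFinD -!meanE//.
under eq_integral do rewrite EFinD.
case: hu hv => mu u01 [mv v01]; rewrite ge0_integralD//.
- by move=> z _; rewrite lee_fin; have /andP[] := u01 z.
- exact/measurable_EFinP.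
- by move=> z _; rewrite lee_fin; have /andP[] := v01 z.
- exact/measurable_EFinP.
Qed.

Lemma mean1 : mean (fun=> 1) = 1.
Proof.
rewrite /mean (_ : (\int[nu]_z 1 = 1)%E)//.
by rewrite integral_cst// mul1e; exact: probability_setT.
Qed.

Lemma unit_valued1B u : unit_valued u -> unit_valued (fun z => 1 - u z).
Proof.
move=> [mu u01]; split; first exact: measurable_funB.
by move=> z; have /andP[? ?] := u01 z; apply/andP; split; lra.
Qed.

Lemma unit_valuedM u v : unit_valued u -> unit_valued v ->
  unit_valued (fun z => u z * v z).
Proof.
move=> [mu u01] [mv v01]; split; first exact: measurable_funM.
move=> z; have /andP[? ?] := u01 z; have /andP[? ?] := v01 z.
by rewrite mulr_ge0// mulr_ile1.
Qed.

Lemma mean1B u : unit_valued u -> mean (fun z => 1 - u z) = 1 - mean u.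
Proof.
move=> hu; have h1 := unit_valued1B hu.
rewrite -[in RHS]mean1; apply/eqP; rewrite eq_sym subr_eq; apply/eqP.
rewrite -meanD//; last first.
  by split=> [|z]; [apply: measurable_funD; [case: h1|case: hu]|rewrite subrK ler01 lexx].
by congr mean; apply/funext => z; rewrite subrK.
Qed.

Lemma mean_split u v : unit_valued u -> unit_valued v ->
  mean u = mean (fun z => u z * v z) + mean (fun z => u z * (1 - v z)).
Proof.
move=> hu hv; rewrite -meanD//.
- by congr mean; apply/funext => z; rewrite -mulrDr subrKC mulr1.
- exact: unit_valuedM.
- exact: unit_valuedM (unit_valued1B hv).
- by under eq_fun do rewrite -mulrDr subrKC mulr1.
Qed.

Lemma mean_ge_measure u (B : set E) (c : R) : unit_valued u -> measurable B ->
  0 <= c -> (forall z, B z -> c <= u z) -> ((c%:E * nu B) <= (mean u)%:E)%E.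
Proof.
move=> hu mB c0 cu; rewrite -meanE//; case: (hu) => mu u01.
rewrite -integral_cst//.
apply: (@le_trans _ _ (\int[nu]_(z in B) (u z)%:E)%E).
  apply: ge0_le_integral => //.
  by apply/measurable_EFinP; exact: measurable_funTS.
apply: ge0_subset_integral => //; first exact/measurable_EFinP.
by move=> z _; rewrite lee_fin; have /andP[] := u01 z.
Qed.

End mean.

(* Two disks of equal radius [a] at distance [v]: the part of one that lies
   outside the other contains a disk of radius [min (v / 2) a]. *)
Lemma crescent_contains_ball (R : realType) (x y : R * R) (a m : R) :
  0 < m -> m <= a -> m <= euclid_norm (y - x) / 2 ->
  exists c : R * R, forall z, euclid_norm (z - c) < m ->
    euclid_norm (y - z) < a /\ a < euclid_norm (x - z).
Proof.
set v := euclid_norm (y - x) => m0 ma mv.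
have v0 : 0 < v by lra.
pose k := (a - m) / v.
have k0 : 0 <= k by rewrite divr_ge0 ?subr_ge0// ltW.
have kv : k * v = a - m by rewrite /k divfK// gt_eqF.
(* The centre lies on the line from [x] through [y], at distance [a - m] beyond [y]: the ball
   touches the disk about [y] from inside, and its points are farther than [v + a - 2 * m >= a] from
   [x]. *)
pose c : R * R := (y.1 + k * (y - x).1, y.2 + k * (y - x).2).
have cy : euclid_norm (y - c) = a - m.
  rewrite euclid_distC -kv -(euclid_norm_scale _ k0); congr euclid_norm.
  by rewrite -[LHS]/(c.1 - y.1, c.2 - y.2) /c /=; congr pair; ring.
have cx : euclid_norm (x - c) = v + (a - m).
  have k1 : 0 <= 1 + k by rewrite addr_ge0.
  have -> : v + (a - m) = (1 + k) * v by rewrite -kv; ring.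
  rewrite euclid_distC -(euclid_norm_scale _ k1).
  congr euclid_norm; rewrite -[LHS]/(c.1 - x.1, c.2 - x.2) /c /=.
  by congr pair; ring.
exists c => z zc; split.
  by rewrite (le_lt_trans (euclid_dist_triangle _ c _))// cy euclid_distC; lra.
have := euclid_dist_triangle x z c; rewrite cx; lra.
Qed.

(** * Joint isolation of two points *)

Section two_point_bound.
Context {R : realType}.
Variables (g : R -> R) (C tau l rho r : R).
Hypothesis g_range : forall x : R, 0 <= x -> 0 <= g x <= 1.
Hypothesis g_nonincreasing : forall x y : R, 0 <= x -> x <= y -> g y <= g x.
Hypothesis C_def : (\int[plane_measure]_z (g (euclid_norm z))%:E)%E = C%:E.
Hypothesis C_gt0 : 0 < C.
Hypothesis tau_range : 0 < tau <= 2^-1.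
Hypothesis l_gt0 : 0 < l.
Hypothesis g_below : forall t, 0 <= t < l -> tau <= g t.
Hypothesis g_above : forall t, l < t -> g t <= 2^-1.
Hypotheses (rho_gt0 : 0 < rho) (r_gt0 : 0 < r) (lr_small : l * r <= 4^-1).

Let f (x : R) := g (x / r).
Let nu := @uniform_square R.
Let phi (x z : R * R) := f (euclid_norm (x - z)).
Let inner : set (R * R) := cell (0, 0) 4^-1.

Let f01 x : 0 <= x -> 0 <= f x <= 1.
Proof. by move=> x0; apply: g_range; rewrite divr_ge0// ltW. Qed.

Let mf : measurable_fun [set: R * R] (fun z => f (euclid_norm z)).
Proof. exact: (measurable_radial g_nonincreasing (ltW r_gt0)). Qed.

Let phi_unit x : unit_valued (phi x).
Proof.
split; last by move=> z; apply: f01; exact: euclid_norm_ge0.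
by apply: (measurable_connection mf).
Qed.

Let phi_ge0 x z : 0 <= phi x z.
Proof. by have /andP[] := (phi_unit x).2 z. Qed.

Let degree x := mean nu (phi x).

Let degree_ge0 x : 0 <= degree x.
Proof. exact: mean_ge0. Qed.

Lemma avoid1E x : 1 - avoid1 f nu x = degree x.
Proof.
rewrite (_ : avoid1 f nu x = mean nu (fun z => 1 - phi x z))//.
by rewrite mean1B// subKr.
Qed.

Let crescent x y := mean nu (fun z => phi y z * (1 - phi x z)).

(** A node linked to [x] or to [y] is either linked to [x], or linked to [y] but not to [x]. *)
Lemma avoid2E x y : 1 - avoid2 f nu x y = degree x + crescent x y.
Proof.
rewrite (_ : avoid2 f nu x y = mean nu (fun z => (1 - phi x z) * (1 - phi y z)))//.
have u1 := unit_valued1B (phi_unit x).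
have := mean_split nu u1 (phi_unit y); rewrite mean1B// -/(degree x).
rewrite (_ : mean nu (fun z => (1 - phi x z) * phi y z) = crescent x y); first lra.
by congr mean; apply/funext => z; rewrite mulrC.
Qed.

Lemma degree_le x : degree x <= r ^+ 2 * C.
Proof.
rewrite -lee_fin -meanE//.
apply: (@le_trans _ _ (\int[plane_measure]_z (phi x z)%:E)%E).
  apply: integral_uniform_square_le; last by move=> z; rewrite lee_fin.
  by apply/measurable_EFinP; case: (phi_unit x).
rewrite /phi /f (integral_radial x r_gt0); last 2 first.
- exact: (measurable_radial1 g_nonincreasing).
- by move=> t /g_range /andP[].
by rewrite C_def.
Qed.

(* A common neighbour of [x] and [y] is at distance at least [|x - y| / 2] from
   one of them. *)
Lemma common_le x y :
  mean nu (fun z => phi y z * phi x z) <=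
  g (euclid_norm (x - y) / (2 * r)) * (degree x + degree y).
Proof.
set k := g _; have /andP[k0 k1] : 0 <= k <= 1.
  by apply: g_range; rewrite divr_ge0 ?euclid_norm_ge0// mulr_ge0// ltW.
have dist_ge0 z : 0 <= euclid_norm z / r.
  by rewrite divr_ge0 ?euclid_norm_ge0// ltW.
have pointwise z : phi y z * phi x z <= k * phi x z + k * phi y z.
  have /andP[x0 x1] := (phi_unit x).2 z; have /andP[y0 y1] := (phi_unit y).2 z.
  have [zx|zx] := leP (euclid_norm (x - y) / 2) (euclid_norm (x - z)).
    have : phi x z <= k.
      apply: g_nonincreasing.
        by rewrite divr_ge0 ?euclid_norm_ge0// mulr_ge0// ltW.
      by rewrite invfM mulrA ler_pM2r ?invr_gt0.
    nra.
  have : phi y z <= k.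
    apply: g_nonincreasing.
      by rewrite divr_ge0 ?euclid_norm_ge0// mulr_ge0// ltW.
    rewrite invfM mulrA ler_pM2r ?invr_gt0//.
    have := euclid_dist_triangle x z y; rewrite (euclid_distC z y); lra.
  nra.
have mphi u : measurable_fun [set: R * R] (fun z => (phi u z)%:E).
  by apply/measurable_EFinP; case: (phi_unit u).
have kphi u : (\int[nu]_z (k * phi u z)%:E = (k * degree u)%:E)%E.
  under eq_integral do rewrite EFinM.
  rewrite ge0_integralZl ?lee_fin//; last by move=> z _; rewrite lee_fin.
  by rewrite (meanE nu (phi_unit u)).
have phi2 : unit_valued (fun z => phi y z * phi x z) by exact: unit_valuedM.
rewrite mulrDr -lee_fin -(meanE nu phi2) EFinD -!kphi -ge0_integralD//; last 4 first.
- by move=> z _; rewrite lee_fin mulr_ge0.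
- by under eq_fun do rewrite EFinM; exact: measurable_funeM.
- by move=> z _; rewrite lee_fin mulr_ge0.
- by under eq_fun do rewrite EFinM; exact: measurable_funeM.
apply: ge0_le_integral => //.
- by move=> z _; rewrite lee_fin mulr_ge0.
- by apply/measurable_EFinP; case: phi2.
- by apply: emeasurable_funD; under eq_fun do rewrite EFinM; exact: measurable_funeM.
by move=> z _; rewrite -EFinD lee_fin.
Qed.

(** Between the disks of radius [l * r] the crescent on the side of [y] holds a ball of radius [m],
    hence a square of area [m ^+ 2]. There [phi y z >= tau] and [1 - phi x z >= 2^-1]. As [y] is in
    the inner square and [l * r <= 4^-1], no part of it leaves [unit_square]. *)
Lemma crescent_ge x y (m : R) : inner y -> 0 < m -> m <= l * r ->
  m <= euclid_norm (y - x) / 2 -> tau / 2 * m ^+ 2 <= crescent x y.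
Proof.
move=> /cellP[y1 y2] m0 ml mv.
have [c Hc] := crescent_contains_ball m0 ml mv.
have inball z : cell c (m / 2) z -> euclid_norm (z - c) < m.
  exact: cell_subset_ball.
have m2 : 0 <= m / 2 by rewrite divr_ge0// ltW.
have cellS : cell c (m / 2) `<=` unit_square.
  move=> z /inball /Hc[/lt_le_trans/(_ lr_small) yz _].
  have : `|y.1 - z.1| <= euclid_norm (y - z) := abs_fst_le_euclid_norm (y - z).
  have : `|y.2 - z.2| <= euclid_norm (y - z) := abs_snd_le_euclid_norm (y - z).
  move: y1 y2; rewrite /unit_square /= !in_itv /= !subr0 !ler_norml.
  by move=> /andP[? ?] /andP[? ?] /andP[? ?] /andP[? ?]; split; apply/andP; split; lra.
have /andP[tau0 tau1] := tau_range.
have := @mean_ge_measure _ _ _ nu _ (cell c (m / 2)) (tau / 2)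
  (unit_valuedM (phi_unit y) (unit_valued1B (phi_unit x))) (measurable_cell _ _).
rewrite (uniform_square_cell m2 cellS) -EFinM lee_fin.
rewrite (_ : 4 * (m / 2) ^+ 2 = m ^+ 2); last by field.
apply; first by rewrite divr_ge0// ltW.
move=> z /inball /Hc[yz xz].
have gy : tau <= phi y z.
  apply: g_below; rewrite divr_ge0 ?euclid_norm_ge0 ?(ltW r_gt0)//=.
  by rewrite ltr_pdivrMr.
have gx : phi x z <= 2^-1 by apply: g_above; rewrite ltr_pdivlMr.
nra.
Qed.

(** The expected degree of a node when the boundary is ignored; the theorem makes it
    [ln rho + b rho]. *)
Let L := rho * r ^+ 2 * C.
Let L_gt0 : 0 < L. Proof. by rewrite !mulr_gt0// exprn_gt0. Qed.
(* The radius that separates near from far pairs: the far ones have few common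
   neighbours, and the near ones fill an area [4 r^2 L], too small to
   compensate the factor [expR (- (kappa * L))]. *)
Let s := r * Num.sqrt L.
Let s_ge0 : 0 <= s. Proof. by rewrite mulr_ge0 ?sqrtr_ge0// ltW. Qed.
(** Chosen so that [kappa * L] is [rho] times the bound of [crescent_ge] at the largest radius,
    [m = l * r]. *)
Let kappa := tau * l ^+ 2 / (2 * C).
Let kappa_gt0 : 0 < kappa.
Proof. by case/andP: tau_range => tau0 _; rewrite divr_gt0 ?mulr_gt0 ?exprn_gt0. Qed.

Let crescent_ge0 x y : 0 <= crescent x y.
Proof. by apply: mean_ge0; exact: unit_valuedM (unit_valued1B _). Qed.

(** Beyond [s] the tail bound caps the factor [g] of [common_le] by [4 / (rho * r ^+ 2)], and the
    two degrees sum to at most [2 * (r ^+ 2 * C)]. The product [8 * C / rho] is an area holding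
    [8 * C] nodes on average, a bounded loss. *)
Lemma crescent_far x y : s < euclid_norm (x - y) ->
  degree y - 8 * C / rho <= crescent x y.
Proof.
set v := euclid_norm (x - y) => sv.
have v0 : 0 < v by exact: le_lt_trans sv.
have -> : crescent x y = degree y - mean nu (fun z => phi y z * phi x z).
  by rewrite /degree (mean_split nu (phi_unit y) (phi_unit x)) addrC addrA addNr add0r.
rewrite lerD2l lerN2 (le_trans (common_le x y))//.
have gk : g (v / (2 * r)) <= 4 / (rho * r ^+ 2).
  have v2r : 0 < v / (2 * r) by rewrite divr_gt0// mulr_gt0.
  rewrite (le_trans (connection_function_tail g_range g_nonincreasing C_def v2r))//.
  have : s ^+ 2 <= v ^+ 2 by rewrite lerXn2r ?nnegrE ?(ltW sv)// ltW.
  rewrite exprMn (sqr_sqrtr (ltW L_gt0)) /L => sv2.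
  rewrite ler_pdivlMr ?mulr_gt0 ?exprn_gt0//.
  have -> : C / (v / (2 * r)) ^+ 2 * (rho * r ^+ 2) =
      4 * (r ^+ 2 * (rho * r ^+ 2 * C) / v ^+ 2).
    by field; rewrite ?gt_eqF.
  by rewrite ler_piMr// ler_pdivrMr ?exprn_gt0// mul1r.
have : degree x + degree y <= 2 * (r ^+ 2 * C).
  by have := degree_le x; have := degree_le y; lra.
have : 0 <= degree x + degree y by rewrite addr_ge0.
move=> d0 d1; apply: (@le_trans _ _ (4 / (rho * r ^+ 2) * (2 * (r ^+ 2 * C)))).
  apply: ler_pM => //; apply: (andP (g_range _)).1.
  by rewrite divr_ge0 ?euclid_norm_ge0// mulr_ge0// ltW.
by rewrite le_eqVlt; apply/orP; left; apply/eqP; field; rewrite ?gt_eqF.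
Qed.

(** The summands answer to pairs farther than [s], pairs within [2 * l * r], and the rest; the
    Gaussian one is [crescent_ge] at half the distance. Adding them instead of separating cases
    allows each to be integrated over the whole square. *)
Lemma avoid2_le x y : inner y ->
  expR (- (rho * (1 - avoid2 f nu x y))) <=
  expR (- (rho * degree x)) *
    (expR (8 * C) * expR (- (rho * degree y)) +
     expR (- (rho * tau / 8 * euclid_norm (x - y) ^+ 2)) +
     expR (- (kappa * L)) * \1_(cell x s) y).
Proof.
move=> Ay; have /andP[tau0 tau1] := tau_range.
rewrite avoid2E mulrDr opprD expRD ler_wpM2l ?expR_ge0//.
have c1 : 0 <= expR (8 * C) * expR (- (rho * degree y)) by rewrite mulr_ge0 ?expR_ge0.
have c2 : 0 <= expR (- (rho * tau / 8 * euclid_norm (x - y) ^+ 2)) by exact: expR_ge0.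
have c3 : 0 <= expR (- (kappa * L)) * \1_(cell x s) y by rewrite mulr_ge0 ?expR_ge0.
have [vs|sv] := leP (euclid_norm (x - y)) s; last first.
  apply: (@le_trans _ _ (expR (8 * C) * expR (- (rho * degree y)))); last lra.
  rewrite -expRD ler_expR; have := crescent_far sv.
  rewrite lerBlDr -(ler_pM2l rho_gt0) mulrDr [rho * (_ / rho)]mulrC divfK ?gt_eqF//.
  lra.
have [vl|lv] := leP (euclid_norm (x - y) / 2) (l * r).
  apply: (@le_trans _ _ (expR (- (rho * tau / 8 * euclid_norm (x - y) ^+ 2)))); last lra.
  rewrite ler_expR lerN2.
  (* Coincident points are set apart because [crescent_ge] needs [0 < m]. *)
  have [->|v0] := eqVneq (euclid_norm (x - y)) 0.
    by rewrite expr0n/= mulr0 mulr_ge0// ltW.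
  have {}v0 : 0 < euclid_norm (x - y) / 2.
    by rewrite divr_gt0// lt_def v0 euclid_norm_ge0.
  have := @crescent_ge x y _ Ay v0 vl; rewrite (euclid_distC y x) lexx => /(_ isT).
  move=> /(ler_wpM2l (ltW rho_gt0)) h; apply: le_trans h.
  by rewrite le_eqVlt; apply/orP; left; apply/eqP; field.
apply: (@le_trans _ _ (expR (- (kappa * L)) * \1_(cell x s) y)); last lra.
rewrite indicE mem_set ?mulr1; last first.
  apply/cellP; split; rewrite distrC.
    exact: le_trans (abs_fst_le_euclid_norm (x - y)) vs.
  exact: le_trans (abs_snd_le_euclid_norm (x - y)) vs.
rewrite ler_expR lerN2.
have lr0 : 0 < l * r by rewrite mulr_gt0.
have := @crescent_ge x y _ Ay lr0 (lexx _); rewrite (euclid_distC y x) (ltW lv) => /(_ isT).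
move=> /(ler_wpM2l (ltW rho_gt0)) h; apply: le_trans h.
rewrite le_eqVlt; apply/orP; left; apply/eqP; rewrite /kappa /L.
by field; rewrite ?gt_eqF.
Qed.

Let mA : measurable inner. Proof. exact: measurable_cell. Qed.

Let m1A : measurable_fun [set: R * R] (\1_inner : R * R -> R).
Proof. exact: measurable_indic. Qed.

Let isolation (x : R * R) : R := \1_inner x * expR (- (rho * (1 - avoid1 f nu x))).

Let expRN_le1 (a : R) : 0 <= a -> expR (- a) <= 1.
Proof. by move=> a0; rewrite -[leRHS]expR0 ler_expR oppr_le0. Qed.

Let isolation_unit : unit_valued isolation.
Proof.
split=> [|z].
  apply: measurable_generating => //; exact: measurable_avoid1.
rewrite /isolation mulr_ge0 ?expR_ge0//= mulr_ile1 ?expR_ge0//.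
by apply: expRN_le1; rewrite avoid1E mulr_ge0// ltW.
Qed.

Definition mean_isolated : R := rho * mean nu isolation.

Lemma first_moment_mean :
  (\int[nu]_x (\1_inner x * rho * expR (- (rho * (1 - avoid1 f nu x))))%:E =
   mean_isolated%:E)%E.
Proof.
rewrite /mean_isolated EFinM -(meanE nu isolation_unit) -ge0_integralZl//.
- by apply: eq_integral => x _; rewrite -EFinM /isolation; congr EFin; ring.
- by apply/measurable_EFinP; case: isolation_unit.
- by move=> x _; rewrite lee_fin; have /andP[] := isolation_unit.2 x.
- by rewrite lee_fin ltW.
Qed.

Lemma mean_isolated_ge : rho * expR (- L) / 4 <= mean_isolated.
Proof.
rewrite /mean_isolated -mulrA ler_pM2l//.
have := @mean_ge_measure _ _ _ nu _ inner (expR (- L)) isolation_unit mA (expR_ge0 _).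
rewrite uniform_square_cell ?invr_ge0//; last first.
  move=> z /cellP; rewrite !subr0 !ler_norml => -[/andP[? ?] /andP[? ?]].
  by rewrite /unit_square /= !in_itv /=; split; apply/andP; split; lra.
rewrite -EFinM lee_fin (_ : 4 * _ = 4^-1); last by field.
apply=> z Az; rewrite /isolation indicE mem_set// mul1r ler_expR lerN2.
rewrite avoid1E /L -mulrA ler_pM2l//; exact: degree_le.
Qed.

(** The first term comes from the Gaussian of rate [rho * tau / 8], whose integral
    [8 * pi / (rho * tau)] is multiplied by [rho]; the second bounds the contribution of the square
    about [x]. *)
Let K1 : R := 8 * pi / tau + 16 / (C * kappa ^+ 2).

Let gaussian x y : R := expR (- (rho * tau / 8 * euclid_norm (x - y) ^+ 2)).

Let measurable_dist x :
  measurable_fun [set: R * R] (fun y => euclid_norm (x - y)).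
Proof.
apply: (measurable_connection (f := id) measurable_euclid_norm) => //.
Qed.

Let measurable_gaussian x : measurable_fun [set: R * R] (gaussian x).
Proof.
rewrite /gaussian; do 2 apply: measurableT_comp => //; apply: measurable_funM => //.
exact: measurable_funX.
Qed.

Let gaussian_ge0 x y : 0 <= gaussian x y. Proof. exact: expR_ge0. Qed.

Let tau_gt0 : 0 < tau. Proof. by case/andP: tau_range. Qed.

Lemma integral_gaussian_le x :
  (\int[nu]_y (rho * gaussian x y)%:E <= (8 * pi / tau)%:E)%E.
Proof.
have c0 : 0 < rho * tau / 8 by rewrite divr_gt0// mulr_gt0.
apply: (@le_trans _ _ (\int[plane_measure]_y (rho * gaussian x y)%:E)%E).
  apply: integral_uniform_square_le; last by move=> y; rewrite lee_fin mulr_ge0// ltW.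
  by apply/measurable_EFinP; exact: measurable_funM.
rewrite ge0_integralZl_real ?(ltW rho_gt0)//; last exact: (measurable_gaussian x).
rewrite (integral_gauss_dist x c0) -EFinM lee_fin.
by rewrite le_eqVlt; apply/orP; left; apply/eqP; field; rewrite ?gt_eqF.
Qed.

(** Since [rho * r ^+ 2 = L / C], the left side is at most [4 / C * L ^+ 2 * expR (- (kappa * L))],
    which is bounded uniformly in [L > 0]. *)
Lemma integral_cell_le x :
  (\int[nu]_y (rho * expR (- (kappa * L)) * \1_(cell x s) y)%:E <=
   (16 / (C * kappa ^+ 2))%:E)%E.
Proof.
have mcell : measurable (cell x s) by exact: measurable_cell.
have k0 : 0 <= rho * expR (- (kappa * L)) by rewrite mulr_ge0 ?expR_ge0// ltW.
rewrite ge0_integralZl_real//.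
rewrite integral_indic// setIT.
apply: (@le_trans _ _ ((rho * expR (- (kappa * L)))%:E * (4 * s ^+ 2)%:E)%E).
  apply: lee_wpmul2l; first by rewrite lee_fin.
  rewrite -(plane_measure_cell x s_ge0).
  apply: (@le_trans _ _ (plane_measure (cell x s `&` unit_square))) => //.
  apply: (@le_measure _ _ _ plane_measure).
  - by apply: mem_set; apply: measurableI => //; exact: measurable_unit_square.
  - exact: mem_set.
  - by move=> z [].
rewrite -EFinM lee_fin /s exprMn (sqr_sqrtr (ltW L_gt0)).
have kL : 0 < kappa * L by rewrite mulr_gt0.
(* This is the square of [q <= expR q] at [q = kappa * L / 2]. *)
have e2 : (kappa * L) ^+ 2 / 4 <= expR (kappa * L).
  rewrite (_ : kappa * L = kappa * L / 2 + kappa * L / 2); last by field.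
  rewrite expRD; have := expR_ge1Dx (kappa * L / 2).
  set q := expR _ => h; have : kappa * L / 2 <= q by lra.
  nra.
have kappa0 := kappa_gt0; have L0 := L_gt0.
have q0 : 0 < expR (kappa * L) by exact: expR_gt0.
rewrite expRN; move: e2 q0; set q := expR _ => e2 q0.
have eL : rho * r ^+ 2 = L / C by rewrite /L mulfK// gt_eqF.
have -> : rho / q * (4 * (r ^+ 2 * L)) = 4 / C * (L ^+ 2 / q).
  rewrite (_ : _ * _ = rho * r ^+ 2 * (4 * L / q)); last by field; rewrite ?gt_eqF.
  by rewrite eL; field; rewrite ?gt_eqF.
have -> : 16 / (C * kappa ^+ 2) = 4 / C * (4 / kappa ^+ 2).
  by field; rewrite ?gt_eqF.
rewrite ler_pM2l ?divr_gt0// ler_pdivrMr// mulrAC ler_pdivlMr ?exprn_gt0//.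
rewrite -exprMn [L * _]mulrC; lra.
Qed.

Let integrand (z : (R * R) * (R * R)) : R :=
  \1_inner z.1 * \1_inner z.2 * rho ^+ 2 * expR (- (rho * (1 - avoid2 f nu z.1 z.2))).

Let integrand_ge0 z : 0 <= integrand z.
Proof. by rewrite /integrand !mulr_ge0 ?expR_ge0 ?exprn_ge0// ltW. Qed.

Let measurable_integrand : measurable_fun [set: (R * R) * (R * R)] integrand.
Proof.
apply: measurable_funM.
  by do 2 apply: measurable_funM => //; apply: measurableT_comp.
apply: measurableT_comp => //; apply: measurableT_comp => //.
apply: measurable_funM => //; apply: measurable_funB => //.
exact: (measurable_avoid2 nu mf f01).
Qed.

Let near_bound x y : R := rho * expR (- (kappa * L)) * \1_(cell x s) y.

Let integrand_le x y : integrand (x, y) <= rho * isolation x *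
  (rho * expR (8 * C) * isolation y + (rho * gaussian x y + near_bound x y)).
Proof.
have b1 : 0 <= near_bound x y by rewrite /near_bound !mulr_ge0 ?expR_ge0// ltW.
have b2 : 0 <= rho * gaussian x y by rewrite mulr_ge0// ltW.
have b3 z : 0 <= isolation z by have /andP[] := isolation_unit.2 z.
have r0 := ltW rho_gt0; have e0 : 0 <= expR (8 * C) by exact: expR_ge0.
have rhs0 : 0 <= rho * isolation x *
    (rho * expR (8 * C) * isolation y + (rho * gaussian x y + near_bound x y)).
  by rewrite mulr_ge0 ?(mulr_ge0 _ (b3 x))// !addr_ge0// !mulr_ge0.
rewrite /integrand /=.
have [Ax|nAx] := pselect (inner x); last first.
  by rewrite [\1_inner x]indicE memNset// !mul0r.
have [Ay|nAy] := pselect (inner y); last first.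
  by rewrite [\1_inner y]indicE memNset// mulr0 !mul0r.
have ix : \1_inner x = 1 :> R by rewrite indicE (mem_set Ax).
have iy : \1_inner y = 1 :> R by rewrite indicE (mem_set Ay).
have isoE z : \1_inner z = 1 :> R -> isolation z = expR (- (rho * degree z)).
  by move=> iz; rewrite /isolation iz mul1r avoid1E.
rewrite ix iy (isoE x ix) (isoE y iy) !mul1r.
apply: (le_trans (ler_wpM2l (sqr_ge0 rho) (avoid2_le x Ay))).
rewrite -/(gaussian x y) /near_bound le_eqVlt; apply/orP; left; apply/eqP.
by move: (expR _) (expR _) (expR _) (expR _) (gaussian x y) (\1_(cell x s) y : R) => *; ring.
Qed.

(** The factor [isolation x] leaves the inner integral, and what remains there is at most [K],
    uniformly in [x]. *)
Lemma second_moment_le :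
  (\int[nu]_x \int[nu]_y (\1_inner x * \1_inner y * rho ^+ 2 *
     expR (- (rho * (1 - avoid2 f nu x y))))%:E <=
   (mean_isolated * (expR (8 * C) * mean_isolated + K1))%:E)%E.
Proof.
have r0 := ltW rho_gt0; have e0 : 0 <= expR (8 * C) by exact: expR_ge0.
have iso0 z : 0 <= isolation z by have /andP[] := isolation_unit.2 z.
have miso : measurable_fun [set: R * R] isolation by case: isolation_unit.
set K := expR (8 * C) * mean_isolated + K1.
have K0 : 0 <= K.
  have K10 : 0 <= K1.
    rewrite addr_ge0//; first by rewrite divr_ge0 ?mulr_ge0 ?pi_ge0// ltW.
    by rewrite divr_ge0// mulr_ge0 ?sqr_ge0// ltW.
  by rewrite addr_ge0// mulr_ge0// mulr_ge0// mean_ge0.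
have inner_le x : (\int[nu]_y (integrand (x, y))%:E <= (rho * isolation x * K)%:E)%E.
  pose u1 y := rho * expR (8 * C) * isolation y.
  pose u2 y := rho * gaussian x y.
  have mn : measurable_fun [set: R * R] (near_bound x).
    apply: measurable_funM => //; apply: measurable_indic; exact: measurable_cell.
  have n0 y : 0 <= near_bound x y.
    by rewrite /near_bound mulr_ge0// mulr_ge0// expR_ge0.
  have mu1 : measurable_fun [set: R * R] u1 by exact: measurable_funM.
  have u10 y : 0 <= u1 y by rewrite /u1 mulr_ge0// mulr_ge0.
  have mu2 : measurable_fun [set: R * R] u2.
    by apply: measurable_funM => //; exact: (measurable_gaussian x).
  have u20 y : 0 <= u2 y by rewrite mulr_ge0.
  have mu3 : measurable_fun [set: R * R] (fun y => u2 y + near_bound x y).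
    exact: measurable_funD.
  have mu4 : measurable_fun [set: R * R] (fun y => u1 y + (u2 y + near_bound x y)).
    exact: measurable_funD.
  apply: (@le_trans _ _ (\int[nu]_y (rho * isolation x *
      (u1 y + (u2 y + near_bound x y)))%:E)%E).
    apply: ge0_le_integral => //.
    - by move=> y _; rewrite lee_fin.
    - by apply/measurable_EFinP; exact: (measurable_fun_pair2 x measurable_integrand).
    - apply/measurable_EFinP.
      exact: (measurable_funM (measurable_cst (rho * isolation x)) mu4).
    - by move=> y _; rewrite lee_fin; exact: integrand_le.
  rewrite ge0_integralZl_real//; last 2 first.
  - by rewrite mulr_ge0.
  - by move=> y; rewrite !addr_ge0.
  rewrite [leRHS]EFinM; apply: lee_wpmul2l; first by rewrite lee_fin mulr_ge0.
  have -> : (\int[nu]_y (u1 y + (u2 y + near_bound x y))%:E =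
      \int[nu]_y (u1 y)%:E + (\int[nu]_y (u2 y)%:E + \int[nu]_y (near_bound x y)%:E))%E.
    under eq_integral do rewrite EFinD.
    rewrite ge0_integralD//; first congr (_ + _)%E.
    - under eq_integral do rewrite EFinD.
      rewrite ge0_integralD//.
      + by move=> y _; rewrite lee_fin.
      + exact/measurable_EFinP.
      + by move=> y _; rewrite lee_fin.
      + exact/measurable_EFinP.
    - by move=> y _; rewrite lee_fin.
    - exact/measurable_EFinP.
    - by move=> y _; rewrite lee_fin addr_ge0.
    - exact/measurable_EFinP.
  rewrite /K /K1 !EFinD; apply: leeD; last first.
    by apply: leeD; [exact: integral_gaussian_le|exact: integral_cell_le].
  rewrite /u1 ge0_integralZl_real// ?mulr_ge0// (meanE nu isolation_unit) -EFinM lee_fin.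
  by rewrite /mean_isolated mulrA [expR _ * rho]mulrC.
apply: (@le_trans _ _ (\int[nu]_x (rho * K * isolation x)%:E)%E).
  apply: ge0_le_integral => //.
  - by move=> x _; apply: integral_ge0 => y _; rewrite lee_fin (integrand_ge0 (x, y)).
  - apply: (measurable_fun_fubini_tonelli_F (m2 := nu) (EFin \o integrand)).
      exact/measurable_EFinP.
    by move=> z; rewrite lee_fin.
  - by apply/measurable_EFinP; exact: measurable_funM.
  - by move=> x _; apply: (le_trans (inner_le x)); rewrite lee_fin mulrAC.
rewrite ge0_integralZl_real ?mulr_ge0// (meanE nu isolation_unit) -EFinM lee_fin.
by rewrite /mean_isolated mulrAC.
Qed.

End two_point_bound.

(** * A lower bound on the probability of disconnection *)

Section disconnection_bound.
Context {R : realType}.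
Variables (g : R -> R) (C tau l rho r m0 : R).
Hypothesis g_range : forall x : R, 0 <= x -> 0 <= g x <= 1.
Hypothesis g_nonincreasing : forall x y : R, 0 <= x -> x <= y -> g y <= g x.
Hypothesis C_def : (\int[plane_measure]_z (g (euclid_norm z))%:E)%E = C%:E.
Hypothesis C_gt0 : 0 < C.
Hypothesis tau_range : 0 < tau <= 2^-1.
Hypothesis l_gt0 : 0 < l.
Hypothesis g_below : forall t, 0 <= t < l -> tau <= g t.
Hypothesis g_above : forall t, l < t -> g t <= 2^-1.
Hypotheses (rho_gt0 : 0 < rho) (r_gt0 : 0 < r) (lr_small : l * r <= 4^-1).
Hypotheses (m0_gt0 : 0 < m0)
  (m0_le : m0 <= rho * expR (- (rho * r ^+ 2 * C)) / 4).
Context {d : measure_display} {T : measurableType d}.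
Variables (P : probability T R) (G : network R T).
Hypothesis G_rcn : random_connection_network P rho (fun x => g (x / r)) G.

(** The constant of [second_moment_le], expressed through [C], [tau] and [l] alone so that it can be
    fixed before [rho] is chosen. *)
Definition variance_constant : R :=
  8 * pi / tau + 16 / (C * (tau * l ^+ 2 / (2 * C)) ^+ 2).

Lemma variance_constant_ge0 : 0 <= variance_constant.
Proof.
have /andP[tau0 _] := tau_range.
apply: addr_ge0; first by rewrite divr_ge0 ?mulr_ge0 ?pi_ge0// ltW.
by rewrite divr_ge0// mulr_ge0 ?sqr_ge0// ltW.
Qed.

(* The parameter of the second-moment inequality is chosen so that its last
   term cancels half of the first moment. *)
Lemma disconnection_bound :
  m0 / (expR (8 * C) * m0 + (variance_constant + 2)) / 2 <=
  1 - fine (P [set w | is_connected G w]) + rho * expR (- rho).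
Proof.
have [[mN _ _ _ _] edges] := G_rcn.
have mC : measurable [set w | is_connected G w] := measurable_connected mN edges.
set m1 := mean_isolated g rho r.
have m01 : m0 <= m1.
  exact: le_trans m0_le (mean_isolated_ge g_range g_nonincreasing C_def rho_gt0 r_gt0).
have m1_gt0 : 0 < m1 by exact: lt_le_trans m01.
set K0 := expR (8 * C); have K0_gt0 : 0 < K0 by exact: expR_gt0.
set K1 := variance_constant; have K1_ge0 : 0 <= K1 by exact: variance_constant_ge0.
have Km_gt0 : 0 < K0 * m1 by rewrite mulr_gt0.
have Km0_gt0 : 0 < K0 * m0 by rewrite mulr_gt0.
have D_gt0 : 0 < K0 * m1 + (K1 + 2) by lra.
(* The summand 2 forces [t <= 2^-1], so that [t ^+ 2 * m1] takes at most half of [t * m1]. *)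
pose t := (K0 * m1 + (K1 + 2))^-1.
have t_gt0 : 0 < t by rewrite invr_gt0.
have tD : t * (K0 * m1 + (K1 + 2)) = 1 by rewrite mulVf// gt_eqF.
have t_le : t <= 2^-1.
  rewrite lef_pV2 ?posrE//.
  lra.
have t02 : 0 <= t <= 2 by rewrite ltW//=; lra.
have f01 x : 0 <= x -> 0 <= g (x / r) <= 1.
  by move=> x0; apply: g_range; rewrite divr_ge0// ltW.
have := isolated_moment_bound (ltW rho_gt0)
  (measurable_radial g_nonincreasing (ltW r_gt0)) f01
  (@uniform_squareE R) (@uniform_square_line R)
  (@measurable_cell R (0, 0) 4^-1) t02 G_rcn.
rewrite first_moment_mean// -/m1 probability_setC//.
have PE : P [set w | is_connected G w] = (fine (P [set w | is_connected G w]))%:E.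
  by rewrite fineK// fin_num_measure.
rewrite PE; set p := fine _.
have m2 := second_moment_le g_range g_nonincreasing C_def C_gt0 tau_range l_gt0
  g_below g_above rho_gt0 r_gt0 lr_small.
move=> /le_trans /(_ (leeD (lexx _) (lee_wpmul2l _ m2))).
rewrite lee_fin sqr_ge0 -/m1 -/variance_constant -/K1 -/K0 => /(_ isT).
rewrite -EFinB -!EFinM -!EFinD lee_fin => main.
have tm1 : t * m1 / 2 <= 1 - p + rho * expR (- rho).
  have : t ^+ 2 * (m1 * (K0 * m1 + K1)) <= t * m1.
    rewrite expr2 -mulrA [t * (m1 * _)]mulrCA ler_pM2l// ler_piMr ?(ltW m1_gt0)//.
    by rewrite -tD ler_pM2l//; lra.
  have : t * t * m1 <= t * m1 / 2.
    by rewrite -mulrA [leRHS]mulrC ler_pM2r// mulr_gt0.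
  move: main; rewrite mulrBr mulrBl => main t1 t2; lra.
(* The quotient [m / (K0 * m + (K1 + 2))] increases with [m], which permits replacing [m1] by its
   lower bound [m0]. *)
apply: le_trans tm1; rewrite ler_pM2r ?invr_gt0// ler_pdivrMr; last lra.
rewrite /t -mulrA ler_pdivlMl//.
have K1m : K1 * m0 <= K1 * m1 by rewrite ler_wpM2l.
rewrite -subr_ge0; have -> : m1 * (K0 * m0 + (K1 + 2)) -
  (K0 * m1 + (K1 + 2)) * m0 = (K1 * m1 - K1 * m0) + 2 * (m1 - m0) by ring.
lra.
Qed.

End disconnection_bound.

Theorem corollary2 (R : realType) (g : R -> R) (C : R) (b : R -> R)
    (g_range : forall x : R, 0 <= x -> 0 <= g x <= 1)
    (g_nonincreasing : forall x y : R, 0 <= x -> x <= y -> g y <= g x)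
    (C_def : (\int[plane_measure]_z (g (euclid_norm z))%:E)%E = C%:E)
    (C_gt0 : 0 < C)
    (g_littleo : (g : R -> R^o) =o_+oo
       (fun x : R => (x ^+ 2 * ln x ^+ 2)^-1 : R^o))
    (b_gt : \forall rho \near +oo, 0 < ln rho + b rho)
    (d : R -> measure_display) (T : forall rho : R, measurableType (d rho))
    (P : forall rho : R, probability (T rho) R)
    (G : forall rho : R, network R (T rho))
    (G_rcn : \forall rho \near +oo,
       random_connection_network (P rho) rho
         (fun x => g (x / connection_range C b rho)) (G rho)) :
  P rho [set w | is_connected (G rho) w] @[rho --> +oo] --> 1%E ->
  b rho @[rho --> +oo] --> +oo.
Proof.
move=> /fine_cvgP[_ /cvgrPdist_lt conn]; apply/cvgryPge => M.
have [tau [l [tau_range l_gt0 g_below g_above]]] :=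
  connection_threshold g_range g_nonincreasing C_def C_gt0.
(* A lower bound for the mean number of isolated nodes as soon as [b rho < M]. The resulting [eta]
   does not involve [rho]; the contradiction comes from splitting it between the probability of
   disconnection and [rho * expR (- rho)]. *)
pose m0 := expR (- M) / 4.
have m0_gt0 : 0 < m0 by rewrite divr_gt0// expR_gt0.
pose eta := m0 / (expR (8 * C) * m0 + (variance_constant C tau l + 2)) / 2.
have eta_gt0 : 0 < eta.
  have v0 : 0 <= variance_constant C tau l by exact: variance_constant_ge0.
  have e0 : 0 < expR (8 * C) * m0 by rewrite mulr_gt0 ?expR_gt0.
  have D0 : 0 < expR (8 * C) * m0 + (variance_constant C tau l + 2) by lra.
  by rewrite divr_gt0// divr_gt0.
have eta2_gt0 : 0 < eta / 2 by rewrite divr_gt0.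
near=> rho.
have rho_gt0 : 0 < rho by near: rho; exact: (nbhs_pinfty_gt (num_real _)).
rewrite leNgt; apply/negP => bM.
have L_gt0 : 0 < ln rho + b rho by near: rho; exact: b_gt.
have Cr_gt0 : 0 < C * rho by rewrite mulr_gt0.
pose r := connection_range C b rho.
have r_gt0 : 0 < r by rewrite sqrtr_gt0 divr_gt0.
have r2 : r ^+ 2 = (ln rho + b rho) / (C * rho).
  by rewrite sqr_sqrtr// divr_ge0// ltW.
have LE : rho * r ^+ 2 * C = ln rho + b rho.
  by rewrite r2; field; rewrite ?gt_eqF.
(* Squared, the claim is [l ^+ 2 * (ln rho + b rho) <= C * rho / 16]. Half of the right side absorbs
   [ln rho <= 2 * Num.sqrt rho], the other half absorbs [M]; hence the constants 64 and 32. *)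
have lr_small : l * r <= 4^-1.
  rewrite -ler_sqr ?nnegrE ?invr_ge0 ?mulr_ge0 ?(ltW l_gt0) ?(ltW r_gt0)//.
  rewrite exprMn r2 mulrA ler_pdivrMr//.
  have sq : Num.sqrt rho ^+ 2 = rho by rewrite sqr_sqrtr// ltW.
  have s_gt0 : 0 < Num.sqrt rho by rewrite sqrtr_gt0.
  have ln_le : ln rho <= 2 * Num.sqrt rho.
    rewrite -{1}sq lnXn//.
    by rewrite -[leLHS]mulr_natl ler_pM2l// ltW// ln_sublinear.
  have big1 : 64 * l ^+ 2 / C <= Num.sqrt rho.
    have c0 : 0 <= 64 * l ^+ 2 / C by rewrite divr_ge0 ?mulr_ge0 ?sqr_ge0// ltW.
    rewrite -ler_sqr ?nnegrE// ?sqrtr_ge0// sq.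
    by near: rho; exact: (nbhs_pinfty_ge (num_real _)).
  have big2 : 32 * l ^+ 2 * M / C <= rho by near: rho; exact: (nbhs_pinfty_ge (num_real _)).
  move: big1 big2; rewrite !ler_pdivrMr// => big1 big2.
  have l2 : 0 < l ^+ 2 by rewrite exprn_gt0.
  have : l ^+ 2 * (ln rho + b rho) <= l ^+ 2 * (2 * Num.sqrt rho + M).
    by rewrite ler_pM2l//; lra.
  have : 64 * l ^+ 2 * Num.sqrt rho <= rho * C.
    have -> : rho * C = Num.sqrt rho * C * Num.sqrt rho by rewrite -{1}sq; ring.
    by rewrite ler_wpM2r ?(ltW s_gt0).
  rewrite exprVn; lra.
have m0_le : m0 <= rho * expR (- (rho * r ^+ 2 * C)) / 4.
  rewrite ler_pM2r ?invr_gt0// LE opprD expRD (expRN (ln rho)) lnK ?posrE//.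
  by rewrite mulrA divff ?gt_eqF// mul1r ler_expR lerN2 ltW.
have rcn : random_connection_network (P rho) rho
    (fun x => g (x / connection_range C b rho)) (G rho).
  by near: rho; exact: G_rcn.
have := disconnection_bound g_range g_nonincreasing C_def C_gt0 tau_range l_gt0
  g_below g_above rho_gt0 r_gt0 lr_small m0_gt0 m0_le rcn.
apply/negP; rewrite -ltNge -/eta.
have conn_rho : `|1 - fine (P rho [set w | is_connected (G rho) w])| < eta / 2.
  by near: rho; exact: conn.
have : rho * expR (- rho) < eta / 2.
  (* From [rho ^+ 2 / 4 <= expR rho] the term is at most [4 / rho], below [eta / 2] once [rho]
     exceeds [8 / eta]. *)
  have big : 8 / eta < rho by near: rho; exact: (nbhs_pinfty_gt (num_real _)).
  rewrite expRN ltr_pdivrMr ?expR_gt0//.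
  have : rho ^+ 2 / 4 <= expR rho.
    rewrite [X in _ <= expR X](_ : rho = rho / 2 + rho / 2); last by field.
    by rewrite expRD; have := expR_ge1Dx (rho / 2); nra.
  move: big; rewrite ltr_pdivrMr//; nra.
have := ler_norm (1 - fine (P rho [set w | is_connected (G rho) w])); lra.
Unshelve. all: by end_near. Qed.
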